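(* The homomorphism $\Delta:\mathcal{P}\to\mathcal{P}\otimes\mathcal{R}$, $$\Delta(P^n)=\sum_{F\subseteq P^n}F\otimes L(P^n/F)=\sum_{F\subseteq P^n}F\otimes[F,P^n]$$ (sum over all non-empty faces $F$ of $P^n$, including $P^n$ itself, where by definition $L(P/P)=[P,P]$), defines on $\mathcal{P}$ the structure of a right graded Hopf comodule over $\mathcal{R}$ such that $$(\varepsilon\otimes\mathrm{id})\Delta P=1\otimes l(P)$$ for every polytope $P$.
   Context: The ground ring is $k=\mathbb{Z}$ or $k=\mathbb{Q}$ (in the latter case $\mathcal{P}$ is replaced by $\mathcal{P}\otimes\mathbb{Q}$). A combinatorial polytope is a combinatorial equivalence class of convex polytopes. The ring of polytopes $\mathcal{P}$ is, as an abelian group, free on all (non-empty) combinatorial polytopes, graded by dimension, with multiplication the direct product and unit the point $\mathrm{pt}=1$. The map $\varepsilon=\xi_0:\mathcal{P}\to k$ is linear with $\varepsilon(\mathrm{pt})=1$, $\varepsilon(P^n)=0$ for $n\ge1$. A finite poset with minimal element $\hat0$ and maximal element $\hat1$ is graded if it has a rank function $\rho$ with $\rho(\hat0)=0$ and $\rho(y)=\rho(x)+1$ whenever $y$ covers $x$; its rank is $\rho(\hat1)$. $\mathcal{R}$ (the Rota–Hopf algebra) is the free $k$-module on isomorphism classes of finite graded posets, graded by rank; its multiplication is the cartesian product of posets, the unit is the one-element poset, the comultiplication is $\Delta(P)=\sum_{\hat0\le z\le\hat1}[\hat0,z]\otimes[z,\hat1]$, and the counit is $1$ on the one-element poset and $0$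 on all other posets. $L(P)$ is the face lattice of a polytope $P$ (including $\varnothing$ and $P$), $P/F$ is the face figure of $F$ in $P$, and $[F,P]$ is the interval between $F$ and $P$ in $L(P)$, so that $L(P/F)\cong[F,P]$. The linear map $l:\mathcal{P}\to\mathcal{R}$ is $l(\mathrm{pt})=\{\hat0\}=1$ and $l(P)=\sum_{v}L(P/v)=\sum_v[v,P]$, the sum over vertices $v$ of $P$. A right Hopf comodule over a Hopf algebra $X$ is a $k$-algebra $M$ with unit which is a (coassociative, counital) right comodule over $X$ whose coaction $M\to M\otimes X$ is a ring homomorphism. *)

(* Defs.v *)
From HB Require Import structures.
From mathcomp Require Import all_boot all_order all_algebra.
From mathcomp Require Import boolp classical_sets fsbigop reals.
From mathcomp Require Import finmap monalg.

Set Implicit Arguments.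
Unset Strict Implicit.
Unset Printing Implicit Defensive.

Import Order.TTheory GRing.Theory Num.Theory.
Local Open Scope quotient_scope.
Local Open Scope classical_set_scope.
Local Open Scope ring_scope.

(* [{malg k[A]}] is the free [k]-module on [A].  The tensor product of the free
  modules on [A] and [B] is the free module on [A * B]; [tens_universal] is its
  universal property.  For commutative monoids [A] and [B] of basis elements,
  [tensM] says that the monoid algebra on [A * B] is the tensor product of the
  monoid algebras on [A] and [B]. *)

Section LinearExtension.
Context (k : comNzRingType) (A : choiceType) (V : lmodType k) (f : A -> V).

Definition lext (x : {malg k[A]}) : V := \sum_(a <- msupp x) x@_a *: f a.

Lemma lextEw (d : {fset A}) (x : {malg k[A]}) : (msupp x `<=` d)%fset ->
  lext x = \sum_(a <- d) x@_a *: f a.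
Proof.
move=> le; rewrite /lext [LHS](big_fset_incl _ le) => //= a _ /mcoeff_outdom ->.
by rewrite scale0r.
Qed.

Lemma lext_is_linear : linear lext.
Proof.
move=> c x y; set d := (msupp x `|` msupp y)%fset.
have sx : (msupp x `<=` d)%fset by exact: fsubsetUl.
have sy : (msupp y `<=` d)%fset by exact: fsubsetUr.
have sxy : (msupp (c *: x + y)%R `<=` d)%fset.
  apply: (fsubset_trans (msuppD_le _ _)).
  by rewrite fsubUset sy (fsubset_trans (msuppZ_le _ _)).
rewrite (lextEw sx) (lextEw sy) (lextEw sxy) scaler_sumr -big_split /=.
by apply: eq_bigr => a _; rewrite mcoeffD mcoeffZ scalerDl scalerA.
Qed.

HB.instance Definition _ :=
  GRing.isLinear.Build k {malg k[A]} V *:%R lext lext_is_linear.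

Lemma lextU a : lext << a >> = f a.
Proof. by rewrite (lextEw msuppU_le) big_seq_fset1 mcoeffUU scale1r. Qed.

Lemma lext_unique (g : {malg k[A]} -> V) :
  linear g -> (forall a, g << a >> = f a) -> g =1 lext.
Proof.
move=> gl gU x.
have gZ c u : g (c *: u) = c *: g u.
  have g0 : g 0 = 0.
    by move: (gl (-1) 0 0); rewrite scaler0 addr0 scaleN1r addNr.
  by move: (gl c u 0); rewrite g0 !addr0.
have gD u v : g (u + v) = g u + g v by have := gl 1 u v; rewrite !scale1r.
rewrite {1}(monalgE x) (big_morph g gD (_ : g 0 = 0)); last first.
  by rewrite -(scale0r (0 : {malg k[A]})) gZ scale0r.
apply: eq_bigr => a _; rewrite -gU -gZ; congr g.
by apply/malgP => b; rewrite mcoeffZ !mcoeffU mulr_natr.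
Qed.

End LinearExtension.

Section Tensor.
Context (k : comNzRingType) (A B : choiceType).

Definition tens (x : {malg k[A]}) (y : {malg k[B]}) : {malg k[(A * B)%type]} :=
  lext (fun a => lext (fun b => << (a, b) >>) y) x.

End Tensor.

Notation "x ⊗ y" := (tens x y) (at level 40, left associativity) : ring_scope.

Section TensorTheory.
Context (k : comNzRingType) (A B : choiceType).
Implicit Types (x : {malg k[A]}) (y : {malg k[B]}).

Lemma tensUU (a : A) (b : B) :
  (<< a >> : {malg k[A]}) ⊗ (<< b >> : {malg k[B]}) = << (a, b) >>.
Proof. by rewrite /tens !lextU. Qed.

Lemma tens_linear_l y : linear (fun x => x ⊗ y).
Proof. by move=> c x x'; rewrite /tens linearP. Qed.

Lemma tens_linear_r x : linear (fun y => x ⊗ y).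
Proof.
move=> c y y'; rewrite /tens /lext scaler_sumr -big_split /=.
apply: eq_bigr => a _; rewrite -!/(lext _ _) linearP.
by rewrite scalerDr !scalerA [x@_a * c]mulrC.
Qed.

Lemma tens_universal (V : lmodType k)
    (phi : {malg k[A]} -> {malg k[B]} -> V) :
  (forall y, linear (phi^~ y)) -> (forall x, linear (phi x)) ->
  exists2 h : {malg k[(A * B)%type]} -> V,
    linear h /\ (forall x y, h (x ⊗ y) = phi x y) &
    forall h' : {malg k[(A * B)%type]} -> V, linear h' ->
      (forall x y, h' (x ⊗ y) = phi x y) -> h' =1 h.
Proof.
move=> phil phir.
pose h := lext (fun ab : A * B => phi << ab.1 >> << ab.2 >>).
exists h; last first.
  by move=> h' h'l h'E; apply: lext_unique => // -[a b]; rewrite -tensUU h'E.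
split; first exact: lext_is_linear.
move=> x y.
have E1 (a : A) : h (<< a >> ⊗ y) = phi << a >> y.
  have -> : h (<< a >> ⊗ y) = lext (fun b => phi << a >> << b >>) y.
    apply: (lext_unique (g := fun y => h (<< a >> ⊗ y))) => [c u v|b].
      by rewrite tens_linear_r /h lext_is_linear.
    by rewrite tensUU /h lextU.
  by rewrite -(lext_unique (phir << a >>)).
have -> : h (x ⊗ y) = lext (fun a => phi << a >> y) x.
  apply: (lext_unique (g := fun x => h (x ⊗ y))) => // c u v.
  by rewrite tens_linear_l /h lext_is_linear.
by rewrite -(lext_unique (phil y)).
Qed.

End TensorTheory.

Section ProductMonoid.
Context (A B : conomType).
Local Open Scope monom_scope.

Definition pair_mul (x y : A * B) : A * B :=
  (mmul x.1 y.1, mmul x.2 y.2).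

Fact pair_mulA : associative pair_mul.
Proof. by move=> x y z; rewrite /pair_mul !mulmA. Qed.
Fact pair_mul1 : left_id (mone, mone) pair_mul.
Proof. by case=> a b; rewrite /pair_mul !mul1m. Qed.
Fact pair_mulr1 : right_id (mone, mone) pair_mul.
Proof. by case=> a b; rewrite /pair_mul !mulm1. Qed.
Fact pair_unitm x y : pair_mul x y = (mone, mone) ->
  x = (mone, mone) /\ y = (mone, mone).
Proof.
by case: x y => [a b] [a' b'] [] /unitm[-> ->] /unitm[-> ->].
Qed.
Fact pair_mulC : commutative pair_mul.
Proof. by move=> x y; rewrite /pair_mul mulmC (mulmC x.2). Qed.

HB.instance Definition _ := Choice_isMonomialDef.Build (A * B)%type
  pair_mulA pair_mul1 pair_mulr1 pair_unitm.
HB.instance Definition _ := MonomialDef_isConomialDef.Build (A * B)%type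
  pair_mulC.

End ProductMonoid.

Lemma bilin_eq (k : comNzRingType) (A B : choiceType) (V : lmodType k)
    (f g : {malg k[A]} -> {malg k[B]} -> V) :
  (forall y, linear (f^~ y)) -> (forall x, linear (f x)) ->
  (forall y, linear (g^~ y)) -> (forall x, linear (g x)) ->
  (forall a b, f << a >> << b >> = g << a >> << b >>) ->
  forall x y, f x y = g x y.
Proof.
move=> fl fr gl gr fg x y.
rewrite (lext_unique (fl y) (fun=> erefl)) (lext_unique (gl y) (fun=> erefl)).
apply: eq_bigr => a _; congr (_ *: _).
rewrite (lext_unique (fr _) (fun=> erefl)) (lext_unique (gr _) (fun=> erefl)).
by apply: eq_bigr => b _; rewrite fg.
Qed.

Lemma malgMUU (k : comNzRingType) (A : conomType) (a a' : A) :
  << a >> * << a' >> = << mmul a a' >> :> {malg k[A]}.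
Proof. by rewrite malgM_def fgmulUU mulr1. Qed.

Lemma tensM (k : comNzRingType) (A B : conomType)
    (x x' : {malg k[A]}) (y y' : {malg k[B]}) :
  (x ⊗ y) * (x' ⊗ y') = (x * x') ⊗ (y * y').
Proof.
move: x' y'; apply: (bilin_eq (f := fun x' y' => (x ⊗ y) * (x' ⊗ y'))
                              (g := fun x' y' => (x * x') ⊗ (y * y'))).
- by move=> y' c u v; rewrite tens_linear_l mulrDr scalerAr.
- by move=> x' c u v; rewrite tens_linear_r mulrDr scalerAr.
- by move=> y' c u v; rewrite mulrDr -scalerAr tens_linear_l.
- by move=> x' c u v; rewrite mulrDr -scalerAr tens_linear_r.
move=> a' b'.
apply: (bilin_eq (f := fun x y => (x ⊗ y) * (<< a' >> ⊗ << b' >>))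
                 (g := fun x y => (x * << a' >>) ⊗ (y * << b' >>))).
- by move=> v c u w; rewrite tens_linear_l mulrDl scalerAl.
- by move=> v c u w; rewrite tens_linear_r mulrDl scalerAl.
- by move=> v c u w; rewrite mulrDl -scalerAl tens_linear_l.
- by move=> v c u w; rewrite mulrDl -scalerAl tens_linear_r.
by move=> a b; rewrite !tensUU !malgMUU tensUU.
Qed.

(* The canonical isomorphisms [k ⊗ M = M = M ⊗ k] are used to identify these
  modules: [contract_l f] is [f ⊗ id] followed by [c ⊗ y |-> c y]. *)

Section TensorMaps.
Context (k : comNzRingType).

Definition tmap (A B A' B' : choiceType) (f : {malg k[A]} -> {malg k[A']})
    (g : {malg k[B]} -> {malg k[B']}) : {malg k[(A * B)%type]} -> {malg k[(A' * B')%type]} :=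
  lext (fun ab => f << ab.1 >> ⊗ g << ab.2 >>).

Definition contract_l (A B : choiceType) (f : {malg k[A]} -> k) :
    {malg k[(A * B)%type]} -> {malg k[B]} :=
  lext (fun ab => f << ab.1 >> *: << ab.2 >>).

Definition contract_r (A B : choiceType) (f : {malg k[B]} -> k) :
    {malg k[(A * B)%type]} -> {malg k[A]} :=
  lext (fun ab => f << ab.2 >> *: << ab.1 >>).

Definition tassoc (A B C : choiceType) :
    {malg k[((A * B) * C)%type]} -> {malg k[(A * (B * C))%type]} :=
  lext (fun t => << (t.1.1, (t.1.2, t.2)) >>).

Definition tmul (B : conomType) : {malg k[(B * B)%type]} -> {malg k[B]} :=
  lext (fun bb => << bb.1 >> * << bb.2 >>).

End TensorMaps.

Section Gradings.
Context (k : comNzRingType).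

(* The degrees of the basis elements define a grading of the free module;
   [graded_basis] says that the monoid algebra is a graded algebra. *)
Definition graded_basis (A : conomType) (deg : A -> nat) : Prop :=
  deg mone = 0%N /\ {morph deg : a b / mmul a b >-> (a + b)%N}.

Definition tdeg (A B : Type) (degA : A -> nat) (degB : B -> nat)
    (ab : A * B) : nat := (degA ab.1 + degB ab.2)%N.

Definition homogeneous (A B : choiceType) (degA : A -> nat) (degB : B -> nat)
    (f : {malg k[A]} -> {malg k[B]}) : Prop :=
  forall a b, b \in msupp (f << a >>) -> degB b = degA a.

End Gradings.

Section Hopf.
Context (k : comNzRingType).

Record antipode (X : conomType) (deg : X -> nat)
    (comul : {malg k[X]} -> {malg k[(X * X)%type]}) (counit : {malg k[X]} -> k)
    (S : {malg k[X]} -> {malg k[X]}) : Prop := Antipode {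
  antipode_linear : linear S;
  antipode_homogeneous : homogeneous deg deg S;
  antipode_l : forall x, tmul (tmap S id (comul x)) = counit x *: 1;
  antipode_r : forall x, tmul (tmap id S (comul x)) = counit x *: 1 }.

Record graded_hopf_algebra (X : conomType) (deg : X -> nat)
    (comul : {malg k[X]} -> {malg k[(X * X)%type]})
    (counit : {malg k[X]} -> k) : Prop := GradedHopfAlgebra {
  hopf_graded_basis : graded_basis deg;
  comul_linear : linear comul;
  comul_homogeneous : homogeneous deg (tdeg deg deg) comul;
  counit_linear : forall c x y, counit (c *: x + y) = c * counit x + counit y;
  counit_homogeneous : forall b, deg b != 0%N -> counit << b >> = 0;
  comul_coassoc : forall x,
    tassoc (tmap comul id (comul x)) = tmap id comul (comul x);
  comul_counit_l : forall x, contract_l counit (comul x) = x;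
  comul_counit_r : forall x, contract_r counit (comul x) = x;
  comul_mul : {morph comul : x y / x * y};
  comul_one : comul 1 = 1;
  counit_mul : {morph counit : x y / x * y};
  counit_one : counit 1 = 1;
  hopf_antipode : exists S, antipode deg comul counit S }.

(* The Hopf algebra axioms of [X] are part of the notion of a comodule over
   the Hopf algebra [X]. *)
Record right_graded_hopf_comodule (M X : conomType)
    (degM : M -> nat) (degX : X -> nat)
    (comul : {malg k[X]} -> {malg k[(X * X)%type]}) (counit : {malg k[X]} -> k)
    (coact : {malg k[M]} -> {malg k[(M * X)%type]}) : Prop :=
  RightGradedHopfComodule {
  comodule_hopf : graded_hopf_algebra degX comul counit;
  comodule_graded_basis : graded_basis degM;
  coact_linear : linear coact;
  coact_homogeneous : homogeneous degM (tdeg degM degX) coact;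
  coact_coassoc : forall x,
    tassoc (tmap coact id (coact x)) = tmap id comul (coact x);
  coact_counit : forall x, contract_r counit (coact x) = x;
  coact_mul : {morph coact : x y / x * y};
  coact_one : coact 1 = 1 }.

End Hopf.

Definition poset_iso (T U : Type) (leT : T -> T -> Prop)
    (leU : U -> U -> Prop) : Prop :=
  exists2 f : T -> U, bijective f & forall x y, leU (f x) (f y) <-> leT x y.

Lemma poset_isoI (T U : Type) (leT : T -> T -> Prop) (leU : U -> U -> Prop)
    (f : T -> U) (g : U -> T) :
  cancel f g -> cancel g f ->
  (forall x y, leT x y -> leU (f x) (f y)) ->
  (forall x y, leU x y -> leT (g x) (g y)) -> poset_iso leT leU.
Proof.
move=> fK gK fm gm; exists f; first by exists g.
by move=> x y; split=> [/gm|/fm//]; rewrite !fK.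
Qed.

Lemma poset_isoE (T U : Type) (leT : T -> T -> Prop) (leU : U -> U -> Prop) :
  poset_iso leT leU -> exists f g, [/\ cancel f g, cancel g f,
    forall x y, leU (f x) (f y) <-> leT x y &
    forall x y, leT (g x) (g y) <-> leU x y].
Proof.
case=> f [g fK gK] fm; exists f, g; split=> // x y.
by rewrite -fm !gK.
Qed.

Lemma poset_iso_refl (T : Type) (le : T -> T -> Prop) : poset_iso le le.
Proof. exact: (@poset_isoI _ _ _ _ id id). Qed.

Lemma poset_iso_sym (T U : Type) (leT : T -> T -> Prop)
  (leU : U -> U -> Prop) : poset_iso leT leU -> poset_iso leU leT.
Proof.
by case/poset_isoE=> f [g] [fK gK fm gm]; exists g => //; exists f.
Qed.

Lemma poset_iso_trans (T U V : Type) (leT : T -> T -> Prop)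
    (leU : U -> U -> Prop) (leV : V -> V -> Prop) :
  poset_iso leT leU -> poset_iso leU leV -> poset_iso leT leV.
Proof.
case=> f bf fm [g bg gm]; exists (g \o f); first exact: bij_comp.
by move=> x y /=; rewrite gm fm.
Qed.

Definition prod_le (T U : Type) (leT : T -> T -> Prop) (leU : U -> U -> Prop)
    (x y : T * U) : Prop := leT x.1 y.1 /\ leU x.2 y.2.

Definition sub_le (T : Type) (le : T -> T -> Prop) (P : T -> Prop)
    (x y : {z | P z}) : Prop := le (sval x) (sval y).

Lemma prod_le_iso (T T' U U' : Type) (leT : T -> T -> Prop)
    (leT' : T' -> T' -> Prop) (leU : U -> U -> Prop) (leU' : U' -> U' -> Prop) :
  poset_iso leT leT' -> poset_iso leU leU' ->
  poset_iso (prod_le leT leU) (prod_le leT' leU').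
Proof.
case/poset_isoE=> f [g] [fK gK fm gm].
case/poset_isoE=> f' [g'] [fK' gK' fm' gm'].
apply: (@poset_isoI _ _ _ _ (fun x => (f x.1, f' x.2))
                            (fun x => (g x.1, g' x.2))).
- by case=> x y /=; rewrite fK fK'.
- by case=> x y /=; rewrite gK gK'.
- by move=> x y [/fm ? /fm' ?].
- by move=> x y [/gm ? /gm' ?].
Qed.

Definition covers (T : Type) (le : T -> T -> Prop) (x y : T) : Prop :=
  [/\ le x y, x <> y & forall z, le x z -> le z y -> z = x \/ z = y].

Record graded_poset (T : Type) (le : T -> T -> Prop) (bot top : T)
    (rho : T -> nat) : Prop := GradedPoset {
  gp_refl : forall x, le x x;
  gp_anti : forall x y, le x y -> le y x -> x = y;
  gp_trans : forall x y z, le x y -> le y z -> le x z;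
  gp_bot : forall x, le bot x;
  gp_top : forall x, le x top;
  gp_rho0 : rho bot = 0%N;
  gp_rhoS : forall x y, covers le x y -> rho y = (rho x).+1 }.

(* [gbot], [gtop] and [grho] are determined by the order [gle]. *)
Record gposet := GPoset {
  gsize : nat;
  gle : rel 'I_gsize;
  gbot : 'I_gsize;
  gtop : 'I_gsize;
  grho : 'I_gsize -> nat;
  gposetP : graded_poset gle gbot gtop grho }.

HB.instance Definition _ := gen_eqMixin gposet.
HB.instance Definition _ := gen_choiceMixin gposet.

Definition giso (p q : gposet) : bool := `[< poset_iso (@gle p) (@gle q) >].

Fact giso_refl : reflexive giso.
Proof. by move=> p; apply/asboolP; exact: poset_iso_refl. Qed.
Fact giso_sym : symmetric giso.
Proof. by move=> p q; apply: asbool_equiv_eq; split; exact: poset_iso_sym. Qed.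
Fact giso_trans : transitive giso.
Proof.
move=> q p r /asboolP pq /asboolP qr; apply/asboolP.
exact: poset_iso_trans pq qr.
Qed.

Canonical giso_equiv := EquivRel giso giso_refl giso_sym giso_trans.

(* [rota] is the type of isomorphism classes of finite graded posets. *)
Definition rota := {eq_quot giso}.
HB.instance Definition _ := EqQuotient.on rota.
HB.instance Definition _ := Choice.on rota.

Fact one_gposet_subproof :
  graded_poset (fun _ _ : 'I_1 => true) ord0 ord0 (fun=> 0%N).
Proof.
split=> // x y; rewrite !ord1 //.
by case=> _ [].
Qed.

Definition one_gposet : gposet := GPoset one_gposet_subproof.

Definition rota_one : rota := \pi one_gposet.

(* The class of a poset [(T, le)] that is finite and graded. For any other
   poset the value is the irrelevant [rota_one]. *)
Definition rota_class (T : Type) (le : T -> T -> Prop) : rota :=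
  \pi_rota (xget one_gposet [set p : gposet | poset_iso (@gle p) le]).

Definition grank (c : rota) : nat := grho (gtop (repr c)).

Definition rota_mul (c d : rota) : rota :=
  rota_class (prod_le (@gle (repr c)) (@gle (repr d))).

Lemma rota_pi (p q : gposet) :
  \pi_rota p = \pi_rota q <-> poset_iso (@gle p) (@gle q).
Proof. by rewrite (rwP (eqmodP _ p q)); split=> /asboolP. Qed.

Lemma rota_repr (p : gposet) :
  poset_iso (@gle (repr (\pi_rota p))) (@gle p).
Proof. by apply/rota_pi; rewrite reprK. Qed.

Lemma rota_eq (c d : rota) :
  poset_iso (@gle (repr c)) (@gle (repr d)) -> c = d.
Proof. by move/rota_pi; rewrite !reprK. Qed.

Lemma rota_classP (T : Type) (le : T -> T -> Prop) :
  (exists p : gposet, poset_iso (@gle p) le) ->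
  poset_iso (@gle (repr (rota_class le))) le.
Proof.
case=> p pT; apply: (poset_iso_trans (rota_repr _)).
by case: xgetP => [q _ //|/(_ p)].
Qed.

Lemma finite_gposet (T : finType) (le : T -> T -> Prop) bot top rho :
  graded_poset le bot top rho -> exists p : gposet, poset_iso (@gle p) le.
Proof.
case=> lexx lea let_ leb lee rho0 rhoS.
pose v (i : 'I_#|T|) : T := enum_val i.
pose r (x : T) : 'I_#|T| := enum_rank x.
have vK : cancel v r by exact: enum_valK.
have rK : cancel r v by exact: enum_rankK.
have P : graded_poset (fun i j : 'I_#|T| => `[< le (v i) (v j) >])
    (r bot) (r top) (rho \o v).
  split=> /=.
  - by move=> x; apply/asboolP.
  - by move=> x y /asboolP xy /asboolP yx; rewrite -(vK x) (lea _ _ xy yx) vK.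
  - by move=> x y z /asboolP xy /asboolP yz; apply/asboolP; exact: let_ xy yz.
  - by move=> x; apply/asboolP; rewrite rK.
  - by move=> x; apply/asboolP; rewrite rK.
  - by rewrite rK.
  - move=> x y [/asboolP xy nxy c]; apply: rhoS; split=> //.
      by move=> /(congr1 r); rewrite !vK.
    move=> z xz zy; case: (c (r z)); rewrite ?rK; try exact/asboolP.
      by move=> <-; left; rewrite rK.
    by move=> <-; right; rewrite rK.
exists (GPoset P); apply: (poset_isoI vK rK) => x y /=.
  by move/asboolP.
by move=> xy; apply/asboolP; rewrite !rK.
Qed.

Lemma prod_graded (T U : Type) leT leU bT tT rT bU tU rU :
  @graded_poset T leT bT tT rT -> @graded_poset U leU bU tU rU ->
  graded_poset (prod_le leT leU) (bT, bU) (tT, tU)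
    (fun x => rT x.1 + rU x.2)%N.
Proof.
case=> Tr Ta Tt Tb Te T0 TS [Ur Ua Ut Ub Ue U0 US]; split.
- by move=> x; split.
- by move=> [x x'] [y y'] [/= ? ?] [/= ? ?]; congr pair; [exact: Ta|exact: Ua].
- move=> x y z [xy xy'] [yz yz']; split; [exact: Tt xy yz|exact: Ut xy' yz'].
- by move=> x; split.
- by move=> x; split.
- by rewrite T0 U0.
move=> [x x'] [y y'] [[/= xy xy'] nxy c].
have [E|E] : (y, x') = (x, x') \/ (y, x') = (y, y').
- by apply: c; split.
- case: E => E; rewrite /= -{}E in nxy c *; rewrite -addnS; congr addn.
  apply: US; split=> //; first by move=> E; apply: nxy; rewrite E.
  move=> z xz zy; have [] := c (y, z); [by split..| |].
    by case; left.
  by case; right.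
- case: E => E; rewrite /= -{}E in nxy c *; rewrite -addSn; congr addn.
  apply: TS; split=> //; first by move=> E; apply: nxy; rewrite E.
  move=> z xz zy; have [] := c (z, x'); [by split..| |].
    by case; left.
  by case; right.
Qed.

Lemma rota_mulP (c d : rota) :
  poset_iso (@gle (repr (rota_mul c d)))
            (prod_le (@gle (repr c)) (@gle (repr d))).
Proof.
apply: rota_classP; apply: finite_gposet.
by apply: prod_graded; exact: gposetP.
Qed.

Fact rota_mulC : commutative rota_mul.
Proof.
move=> c d; apply: rota_eq; apply: (poset_iso_trans (rota_mulP c d)).
apply: (poset_iso_trans _ (poset_iso_sym (rota_mulP d c))).
apply: (@poset_isoI _ _ _ _ (fun x => (x.2, x.1)) (fun x => (x.2, x.1))).
- by case.
- by case.
- by move=> ? ? [].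
- by move=> ? ? [].
Qed.

Fact rota_mulA : associative rota_mul.
Proof.
move=> c d e; apply: rota_eq.
apply: (poset_iso_trans (rota_mulP _ _)).
apply: (poset_iso_trans (prod_le_iso (poset_iso_refl _) (rota_mulP d e))).
apply: (poset_iso_trans _ (poset_iso_sym (rota_mulP _ _))).
apply: (poset_iso_trans _ (prod_le_iso (poset_iso_sym (rota_mulP c d))
                                       (poset_iso_refl _))).
apply: (@poset_isoI _ _ _ _ (fun x => ((x.1, x.2.1), x.2.2))
                            (fun x => (x.1.1, (x.1.2, x.2)))).
- by case=> ? [].
- by case=> [[]].
- by move=> ? ? [? [? ?]]; split=> //; split.
- by move=> ? ? [[? ?] ?]; split=> //; split.
Qed.

Fact rota_mul1 : left_id rota_one rota_mul.
Proof.
move=> c; apply: rota_eq; apply: (poset_iso_trans (rota_mulP _ _)).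
apply: (poset_iso_trans (prod_le_iso (rota_repr _) (poset_iso_refl _))).
apply: (@poset_isoI _ _ _ _ snd (fun x => (ord0, x))) => //.
- by case=> i x; rewrite (ord1 i).
- by move=> ? ? [].
Qed.

Fact rota_mulr1 : right_id rota_one rota_mul.
Proof. by move=> c; rewrite rota_mulC rota_mul1. Qed.

Fact rota_unitm (c d : rota) : rota_mul c d = rota_one ->
  c = rota_one /\ d = rota_one.
Proof.
have H (a b : rota) : rota_mul a b = rota_one -> a = rota_one.
  move=> E; have := rota_mulP a b; rewrite E => /poset_iso_sym ab.
  have {ab} [f [g fK gK] fm] := poset_iso_trans ab (rota_repr _).
  have pt (x y : 'I_(gsize (repr a)) * 'I_(gsize (repr b))) : x = y.
    by rewrite -(fK x) -(fK y) (ord1 (f x)) (ord1 (f y)).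
  apply: rota_eq; apply: (poset_iso_trans _ (poset_iso_sym (rota_repr _))).
  apply: (@poset_isoI _ _ _ _ (fun=> ord0) (fun=> gbot (repr a))) => //=.
  - by move=> x; have /(congr1 fst) := pt (gbot (repr a), gbot (repr b))
                                          (x, gbot (repr b)).
  - by move=> x; rewrite (ord1 x).
  - by move=> x y _; exact: gp_refl (gposetP _) _.
by move=> E; split; [exact: H E|apply: (H d c); rewrite rota_mulC].
Qed.

HB.instance Definition _ := Choice_isMonomialDef.Build rota
  rota_mulA rota_mul1 rota_mulr1 rota_unitm.
HB.instance Definition _ := MonomialDef_isConomialDef.Build rota rota_mulC.

Section RotaHopf.
Context (k : comNzRingType).

Definition rota_comul : {malg k[rota]} -> {malg k[(rota * rota)%type]} :=
  lext (fun c : rota => let p := repr c in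
    \sum_(z < gsize p)
      << rota_class (sub_le (@gle p) (P := fun x => gle x z)) >> ⊗
      << rota_class (sub_le (@gle p) (P := fun x => gle z x)) >>).

Definition rota_counit : {malg k[rota]} -> k :=
  lext (fun c : rota => (c == mone)%:R : k^o).

End RotaHopf.

Arguments rota_comul k x : clear implicits.
Arguments rota_counit k x : clear implicits.

Section Polytopes.
Context (R : realType).

Definition simplex (m : nat) : set 'rV[R]_m :=
  [set w | (forall i, 0 <= w 0 i) /\ \sum_i w 0 i = 1].

(* The convex hull of the rows of [V]. *)
Definition convex_hull (m n : nat) (V : 'M[R]_(m, n)) : set 'rV[R]_n :=
  [set w *m V | w in @simplex m].

Record polytope := Polytope {
  ambient_dim : nat;
  body :> set 'rV[R]_ambient_dim;
  body_hull : exists (m : nat) (V : 'M[R]_(m, ambient_dim)),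
    body = convex_hull V;
  body_nonempty : body !=set0 }.
Arguments body : clear implicits.

HB.instance Definition _ := gen_eqMixin polytope.
HB.instance Definition _ := gen_choiceMixin polytope.

(* The functional [c = 0] gives the faces [P] (with [b = 0]) and [set0] (with
   [b = 1]). *)
Definition is_face (n : nat) (P F : set 'rV[R]_n) : Prop :=
  exists (c : 'cV[R]_n) (b : R),
    (forall x, P x -> (x *m c) 0 0 <= b) /\
    F = [set x | P x /\ (x *m c) 0 0 = b].

Record face (n : nat) (P : set 'rV[R]_n) := Face {
  face_set :> set 'rV[R]_n;
  faceP : is_face P face_set }.
Arguments face_set {n P} f _.

Record nface (n : nat) (P : set 'rV[R]_n) := NFace {
  nface_face :> face P;
  nface_nonempty : nface_face !=set0 }.

HB.instance Definition _ (n : nat) (P : set 'rV[R]_n) :=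
  gen_eqMixin (nface P).
HB.instance Definition _ (n : nat) (P : set 'rV[R]_n) :=
  gen_choiceMixin (nface P).

Definition face_le (n : nat) (P : set 'rV[R]_n) (F G : face P) : Prop :=
  F `<=` G.

(* [face P], ordered by inclusion, is the face lattice of [P], including the
   empty face. *)
Definition comb_equiv (P Q : polytope) : bool :=
  `[< poset_iso (@face_le _ P) (@face_le _ Q) >].

Fact comb_equiv_refl : reflexive comb_equiv.
Proof. by move=> p; apply/asboolP; exact: poset_iso_refl. Qed.
Fact comb_equiv_sym : symmetric comb_equiv.
Proof. by move=> p q; apply: asbool_equiv_eq; split; exact: poset_iso_sym. Qed.
Fact comb_equiv_trans : transitive comb_equiv.
Proof.
move=> q p r /asboolP pq /asboolP qr; apply/asboolP.
exact: poset_iso_trans pq qr.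
Qed.

Canonical comb_equiv_equiv :=
  EquivRel comb_equiv comb_equiv_refl comb_equiv_sym comb_equiv_trans.

Definition cpolytope := {eq_quot comb_equiv}.
HB.instance Definition _ := EqQuotient.on cpolytope.
HB.instance Definition _ := Choice.on cpolytope.

Definition comb_class (P : polytope) : cpolytope := \pi P.

Lemma comb_classP (P Q : polytope) : comb_class P = comb_class Q <->
  poset_iso (@face_le _ P) (@face_le _ Q).
Proof. by rewrite (rwP (eqmodP _ P Q)); split=> /asboolP. Qed.

(* The dimension of the affine hull of [P]. *)
Definition affine_dim (n : nat) (P : set 'rV[R]_n) : nat :=
  \max_(r < n.+1 | `[< exists (x : 'rV[R]_n) (A : 'M[R]_n),
      [/\ P x, forall i, P (x + row i A) & \rank A = r] >]) r.

Definition cdim (p : cpolytope) : nat := affine_dim (repr p).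

Lemma simplexM (m m' : nat) (w : 'rV[R]_m) (S : 'M[R]_(m, m')) :
  simplex w -> (forall i, simplex (row i S)) -> simplex (w *m S).
Proof.
move=> [w0 w1] S1; split.
  move=> j; rewrite mxE; apply: sumr_ge0 => i _; apply: mulr_ge0 => //.
  by have [/(_ j)] := S1 i; rewrite mxE.
rewrite -w1; under eq_bigr do rewrite mxE.
rewrite exchange_big /=; apply: eq_bigr => i _.
rewrite -mulr_sumr; have [_] := S1 i.
by under eq_bigr do rewrite mxE; move=> ->; rewrite mulr1.
Qed.

Lemma simplex_delta (m : nat) (i : 'I_m) : simplex (delta_mx 0 i : 'rV[R]_m).
Proof.
split; first by move=> j; rewrite mxE eqxx /= ler0n.
rewrite (bigD1 i) //= mxE !eqxx big1 ?addr0 // => j ji.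
by rewrite mxE eqxx (negbTE ji).
Qed.

Lemma hull_row (m n : nat) (V : 'M[R]_(m, n)) i : convex_hull V (row i V).
Proof. by exists (delta_mx 0 i); [exact: simplex_delta|rewrite rowE]. Qed.

Lemma hull_le (m n : nat) (V : 'M[R]_(m, n)) (c : 'cV[R]_n) (b : R) :
  (forall i, (row i V *m c) 0 0 <= b) ->
  forall x, convex_hull V x -> (x *m c) 0 0 <= b.
Proof.
move=> Vb _ [w [w0 w1] <-]; rewrite -mulmxA mxE -[b]mul1r -w1 mulr_suml.
apply: ler_sum => i _; apply: ler_wpM2l => //.
by have := Vb i; rewrite -row_mul mxE.
Qed.

Lemma face_hull (m n : nat) (V : 'M[R]_(m, n)) (F : set 'rV[R]_n) :
  is_face (convex_hull V) F -> F !=set0 ->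
  exists (m' : nat) (V' : 'M[R]_(m', n)), F = convex_hull V'.
Proof.
case=> c [b [le_b ->]] [x0 [[w0 [w0_ge0 w0_1] <-]]].
have bE (w : 'rV_m) : simplex w -> (w *m V *m c) 0 0 = b ->
    forall i, (row i V *m c) 0 0 != b -> w 0 i = 0.
  move=> [w_ge0 w_1] E i ne.
  have ge0 j : 0 <= w 0 j * (b - (row j V *m c) 0 0).
    by apply: mulr_ge0 => //; rewrite subr_ge0 le_b //; exact: hull_row.
  have : \sum_j w 0 j * (b - (row j V *m c) 0 0) = 0.
    under eq_bigr do rewrite mulrBr.
    rewrite sumrB -mulr_suml w_1 mul1r -{1}E -mulmxA mxE.
    apply/eqP; rewrite subr_eq0; apply/eqP/eq_bigr => j _.
    by rewrite -row_mul [in RHS]mxE.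
  move/eqP; rewrite psumr_eq0; last by move=> j _; exact: ge0.
  move/allP/(_ i (mem_index_enum _)); rewrite /= mulf_eq0 subr_eq0.
  by rewrite [b == _]eq_sym (negbTE ne) orbF => /eqP.
move=> E0; have [i0 i0b] : exists i, (row i V *m c) 0 0 == b.
  apply/existsP; rewrite -[X in is_true X]negbK negb_exists; apply/negP.
  move=> /forallP no; have := w0_1; rewrite big1 => [/eqP|i _].
    by rewrite eq_sym oner_eq0.
  exact: (bE w0).
pose f i := if (row i V *m c) 0 0 == b then i else i0.
have fb i : (row (f i) V *m c) 0 0 = b.
  by rewrite /f; case: ifP => [/eqP|_]; last exact/eqP.
pose S : 'M[R]_m := \matrix_i delta_mx 0 (f i).
have rS i : row i (S *m V) = row (f i) V by rewrite row_mul rowK -rowE.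
exists m, (S *m V); apply/seteqP; split=> [x [[w sw <-]] E|x [w sw <-]].
  exists w => //; rewrite !mulmx_sum_row; apply: eq_bigr => i _.
  rewrite rS /f; case: ifP => // /negbT ne.
  by rewrite (bE w sw E _ ne) !scale0r.
split.
  by exists (w *m S); rewrite ?mulmxA //; apply: simplexM => // i;
     rewrite rowK; exact: simplex_delta.
have [_ w1] := sw; rewrite -mulmxA mxE -[RHS]mul1r -w1 mulr_suml.
by apply: eq_bigr => i _; congr (_ * _); rewrite -(fb i) -rS -row_mul [RHS]mxE.
Qed.

Lemma nface_hull (P : polytope) (F : nface P) :
  exists (m : nat) (V : 'M[R]_(m, ambient_dim P)), (F : set _) = convex_hull V.
Proof.
have [m [V E]] := body_hull P; apply: (@face_hull m _ V).
  by rewrite -E; exact: faceP.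
exact: nface_nonempty.
Qed.

Definition face_polytope (P : polytope) (F : nface P) : polytope :=
  Polytope (nface_hull F) (nface_nonempty F).

Definition pprod_set (m n : nat) (P : set 'rV[R]_m) (Q : set 'rV[R]_n) :
  set 'rV[R]_(m + n) := [set x | P (lsubmx x) /\ Q (rsubmx x)].

Lemma pprod_setE (m n : nat) (P : set 'rV[R]_m) (Q : set 'rV[R]_n) x y :
  pprod_set P Q (row_mx x y) <-> P x /\ Q y.
Proof. by rewrite /pprod_set /= row_mxKl row_mxKr. Qed.

Fact pprod_hull (P Q : polytope) :
  exists (m : nat) (V : 'M[R]_(m, ambient_dim P + ambient_dim Q)),
    pprod_set P Q = convex_hull V.
Proof.
have [m [V ->]] := body_hull P; have [n [W ->]] := body_hull Q.
have [N [e e_bij]] : exists N (e : 'I_N -> 'I_m * 'I_n), bijective e.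
  by exists #|(('I_m * 'I_n)%type : finType)|, enum_val; exact: enum_val_bij.
pose S1 : 'M[R]_(N, m) :=
  \matrix_t delta_mx 0 (e t).1.
pose S2 : 'M[R]_(N, n) :=
  \matrix_t delta_mx 0 (e t).2.
exists N, (row_mx (S1 *m V) (S2 *m W)).
apply/seteqP; split=> [x [[v [v0 v1] vE] [w [w0 w1] wE]]|_ [u su <-]]; last first.
  rewrite mul_mx_row !mulmxA; apply/pprod_setE; split.
    exists (u *m S1) => //; apply: simplexM => // i.
    by rewrite rowK; exact: simplex_delta.
  exists (u *m S2) => //; apply: simplexM => // i.
  by rewrite rowK; exact: simplex_delta.
pose u : 'rV[R]_N :=
  \row_t (v 0 (e t).1 * w 0 (e t).2).
have sumE (F : 'I_m * 'I_n -> R) :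
    \sum_t F (e t) = \sum_i \sum_j F (i, j).
  rewrite pair_big /=.
  rewrite [RHS](reindex e (onW_bij _ e_bij)) /=.
  by apply: eq_bigr => t _; case: (e t).
exists u; first split.
- by move=> t; rewrite mxE mulr_ge0.
- under eq_bigr do rewrite mxE.
  rewrite (sumE (fun ij => v 0 ij.1 * w 0 ij.2)) -v1; apply: eq_bigr => i _ /=.
  by rewrite -mulr_sumr w1 mulr1.
have E1 : u *m S1 = v.
  apply/rowP => a; rewrite mxE.
  under eq_bigr do rewrite !mxE /=.
  rewrite (sumE (fun ij => v 0 ij.1 * w 0 ij.2 * (a == ij.1)%:R)) (bigD1 a) //=.
  rewrite [X in _ + X]big1 => [|i ne].
    by rewrite eqxx; under eq_bigr do rewrite mulr1;
       rewrite -mulr_sumr w1 mulr1 addr0.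
  by rewrite big1 // => j _; rewrite eq_sym (negbTE ne) mulr0.
have E2 : u *m S2 = w.
  apply/rowP => a; rewrite mxE.
  under eq_bigr do rewrite !mxE /=.
  rewrite (sumE (fun ij => v 0 ij.1 * w 0 ij.2 * (a == ij.2)%:R)) exchange_big.
  rewrite (bigD1 a) //= [X in _ + X]big1 => [|j ne].
    by rewrite eqxx; under eq_bigr do rewrite mulr1;
       rewrite -mulr_suml v1 mul1r addr0.
  by rewrite big1 // => i _; rewrite eq_sym (negbTE ne) mulr0.
by rewrite mul_mx_row !mulmxA E1 E2 vE wE hsubmxK.
Qed.

Fact pprod_nonempty (P Q : polytope) : pprod_set P Q !=set0.
Proof.
have [x Px] := body_nonempty P; have [y Qy] := body_nonempty Q.
by exists (row_mx x y); apply/pprod_setE.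
Qed.

Definition pprod (P Q : polytope) : polytope :=
  Polytope (pprod_hull P Q) (pprod_nonempty P Q).

Fact point_hull : exists (m : nat) (V : 'M[R]_(m, 0)),
  [set: 'rV[R]_0] = convex_hull V.
Proof.
exists 1%N, 0; apply/seteqP; split=> // x _; exists (delta_mx 0 0).
  exact: simplex_delta.
by rewrite /= [LHS]thinmx0 [RHS]thinmx0.
Qed.

Fact point_nonempty : [set: 'rV[R]_0] !=set0.
Proof. by exists 0. Qed.

Definition point : polytope := Polytope point_hull point_nonempty.

Definition cprod (p q : cpolytope) : cpolytope :=
  comb_class (pprod (repr p) (repr q)).

Lemma face_eq (n : nat) (P : set 'rV[R]_n) (F G : face P) :
  (F : set _) = G -> F = G.
Proof.
case: F G => F hF [G hG] /= E; rewrite -{G}E in hG *.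
by congr Face; exact: Prop_irrelevance.
Qed.

Fact empty_is_face (n : nat) (P : set 'rV[R]_n) : is_face P set0.
Proof.
exists 0, 1; split=> [x _|]; first by rewrite mulmx0 mxE ler01.
apply/seteqP; split=> // x [_]; rewrite mulmx0 mxE => /eqP.
by rewrite eq_sym oner_eq0.
Qed.

Fact full_is_face (n : nat) (P : set 'rV[R]_n) : is_face P P.
Proof.
exists 0, 0; split=> [x _|]; first by rewrite mulmx0 mxE.
by apply/seteqP; split=> [x|x []//]; split=> //; rewrite mulmx0 mxE.
Qed.

Lemma face_sub (n : nat) (P : set 'rV[R]_n) (F : face P) : F `<=` P.
Proof. by case: (faceP F) => c [b [_ ->]] x []. Qed.

Definition fempty (n : nat) (P : set 'rV[R]_n) : face P :=
  Face (empty_is_face P).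
Definition ffull (n : nat) (P : set 'rV[R]_n) : face P :=
  Face (full_is_face P).

Section FacesOfProduct.
Context (m n : nat) (P : set 'rV[R]_m) (Q : set 'rV[R]_n).

Lemma pprod_is_face (F : set 'rV[R]_m) (G : set 'rV[R]_n) :
  is_face P F -> is_face Q G -> is_face (pprod_set P Q) (pprod_set F G).
Proof.
move=> hF hG.
have [[[x Fx] [y Gy]]|no] := pselect (F !=set0 /\ G !=set0); last first.
  suff -> : pprod_set F G = set0 by exact: empty_is_face.
  apply/seteqP; split=> // z [Fz Gz]; apply: no; split.
    by exists (lsubmx z).
  by exists (rsubmx z).
case: hF => c [b [cb FE]]; case: hG => d [e [de GE]].
have cE z : (z *m col_mx c d) 0 0 =
    (lsubmx z *m c) 0 0 + (rsubmx z *m d) 0 0.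
  by rewrite -{1}[z]hsubmxK mul_row_col mxE.
exists (col_mx c d), (b + e); split=> [z [Pz Qz]|].
  by rewrite cE lerD ?cb ?de.
apply/seteqP; split=> z.
  by rewrite FE GE => -[[Pz zb] [Qz ze]]; split; [split|rewrite cE zb ze].
case=> -[Pz Qz]; rewrite cE FE GE => zE.
have lz := cb _ Pz; have rz := de _ Qz.
split; split=> //; apply/eqP; rewrite eq_le ?lz ?rz /=.
  by rewrite -(lerD2r e) -zE lerD2l.
by rewrite -(lerD2l b) -zE lerD2r.
Qed.

Definition fprod (F : face P) (G : face Q) : face (pprod_set P Q) :=
  Face (pprod_is_face (faceP F) (faceP G)).

Definition fpr1_set (H : set 'rV[R]_(m + n)) : set 'rV[R]_m :=
  [set x | exists y, H (row_mx x y)].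
Definition fpr2_set (H : set 'rV[R]_(m + n)) : set 'rV[R]_n :=
  [set y | exists x, H (row_mx x y)].

Lemma fpr_setE (F : set 'rV[R]_m) (G : set 'rV[R]_n) :
  (F !=set0 <-> G !=set0) ->
  fpr1_set (pprod_set F G) = F /\ fpr2_set (pprod_set F G) = G.
Proof.
move=> FG; split; apply/seteqP; split=> [x [y]|x Fx]; rewrite ?pprod_setE.
- by case.
- have [y Gy] : G !=set0 by apply/FG; exists x.
  by exists y; rewrite pprod_setE.
- by case.
- have [y Gy] : F !=set0 by apply/FG; exists x.
  by exists y; rewrite pprod_setE.
Qed.

Lemma face_of_prod (H : set 'rV[R]_(m + n)) : is_face (pprod_set P Q) H ->
  [/\ is_face P (fpr1_set H), is_face Q (fpr2_set H) &
      pprod_set (fpr1_set H) (fpr2_set H) = H].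
Proof.
have [[z0 Hz0] [c [b [cb HE]]]|no _] := pselect (H !=set0); last first.
  have -> : H = set0.
    by apply/seteqP; split=> // z Hz; apply: no; exists z.
  have -> : fpr1_set set0 = set0 by apply/seteqP; split=> // x [].
  have -> : fpr2_set set0 = set0 by apply/seteqP; split=> // x [].
  split; [exact: empty_is_face|exact: empty_is_face|].
  by apply/seteqP; split=> // z [].
pose c1 := usubmx c; pose c2 := dsubmx c.
have cE z : (z *m c) 0 0 = (lsubmx z *m c1) 0 0 + (rsubmx z *m c2) 0 0.
  by rewrite -{1}[z]hsubmxK -{1}[c]vsubmxK mul_row_col mxE.
have [[Pz0 Qz0] z0b] : (pprod_set P Q) z0 /\ (z0 *m c) 0 0 = b.
  by rewrite HE in Hz0.
pose b1 := (lsubmx z0 *m c1) 0 0; pose b2 := (rsubmx z0 *m c2) 0 0.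
have bE : b = b1 + b2 by rewrite -z0b cE.
have le1 x : P x -> (x *m c1) 0 0 <= b1.
  move=> Px; have := cb (row_mx x (rsubmx z0)).
  by rewrite pprod_setE cE row_mxKl row_mxKr bE lerD2r; apply.
have le2 y : Q y -> (y *m c2) 0 0 <= b2.
  move=> Qy; have := cb (row_mx (lsubmx z0) y).
  by rewrite pprod_setE cE row_mxKl row_mxKr bE lerD2l; apply.
pose F := [set x | P x /\ (x *m c1) 0 0 = b1].
pose G := [set y | Q y /\ (y *m c2) 0 0 = b2].
have -> : H = pprod_set F G.
  rewrite HE; apply/seteqP; split=> z /=.
    case=> -[Pz Qz]; rewrite cE bE => zE.
    have lz := le1 _ Pz; have rz := le2 _ Qz.
    split; split=> //; apply/eqP; rewrite eq_le ?lz ?rz /=.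
      by rewrite -(lerD2r b2) -zE lerD2l.
    by rewrite -(lerD2l b1) -zE lerD2r.
  by case=> -[Pz z1] [Qz z2]; split=> //; rewrite cE z1 z2.
have [] := @fpr_setE F G; last first.
  by move=> -> ->; split=> //; [exists c1, b1|exists c2, b2].
by split=> _; [exists (rsubmx z0)|exists (lsubmx z0)].
Qed.

Definition fpr1 (H : face (pprod_set P Q)) : face P :=
  Face (let: And3 h _ _ := face_of_prod (faceP H) in h).
Definition fpr2 (H : face (pprod_set P Q)) : face Q :=
  Face (let: And3 _ h _ := face_of_prod (faceP H) in h).

Lemma fprK (H : face (pprod_set P Q)) : fprod (fpr1 H) (fpr2 H) = H.
Proof. by apply: face_eq => /=; case: (face_of_prod (faceP H)). Qed.

Lemma fprodK (F : face P) (G : face Q) :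
  ((F : set _) !=set0 <-> (G : set _) !=set0) ->
  fpr1 (fprod F G) = F /\ fpr2 (fprod F G) = G.
Proof. by move=> /fpr_setE[E1 E2]; split; apply: face_eq. Qed.

Lemma fpr_nonempty (H : face (pprod_set P Q)) :
  (fpr1 H : set _) !=set0 <-> (fpr2 H : set _) !=set0.
Proof. by split=> -[x [y Hxy]]; exists y, x. Qed.

Lemma fprod_le (F F' : face P) (G G' : face Q) :
  face_le F F' -> face_le G G' -> face_le (fprod F G) (fprod F' G').
Proof. by move=> s s' z [/s ? /s' ?]. Qed.

Lemma fpr_le (H K : face (pprod_set P Q)) : face_le H K ->
  face_le (fpr1 H) (fpr1 K) /\ face_le (fpr2 H) (fpr2 K).
Proof. by move=> s; split=> x [y /s ?]; exists y. Qed.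

End FacesOfProduct.

Lemma poset_iso_empty (m n : nat) (P : set 'rV[R]_m) (P' : set 'rV[R]_n)
    (f : face P -> face P') (g : face P' -> face P) (F : face P) :
  cancel g f -> (forall x y, face_le (f x) (f y) <-> face_le x y) ->
  (f F : set _) !=set0 <-> (F : set _) !=set0.
Proof.
move=> gK fm; split=> -[x hx].
  apply: contrapT => no.
  have : face_le F (g (fempty P')) by move=> y Fy; case: no; exists y.
  by rewrite -fm gK => /(_ x hx).
apply: contrapT => no.
have : face_le (f F) (f (fempty P)) by move=> y Fy; case: no; exists y.
by rewrite fm => /(_ x hx).
Qed.

Lemma pprod_iso (P P' Q Q' : polytope) :
  poset_iso (@face_le _ P) (@face_le _ P') ->
  poset_iso (@face_le _ Q) (@face_le _ Q') ->
  poset_iso (@face_le _ (pprod P Q)) (@face_le _ (pprod P' Q')).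
Proof.
case/poset_isoE=> f [f' [fK f'K fm f'm]].
case/poset_isoE=> g [g' [gK g'K gm g'm]].
have fne F := @poset_iso_empty _ _ P P' f f' F f'K fm.
have f'ne F := @poset_iso_empty _ _ P' P f' f F fK f'm.
have gne F := @poset_iso_empty _ _ Q Q' g g' F g'K gm.
have g'ne F := @poset_iso_empty _ _ Q' Q g' g F gK g'm.
apply: (@poset_isoI _ _ _ _
  (fun H => fprod (f (fpr1 H)) (g (fpr2 H)))
  (fun H => fprod (f' (fpr1 H)) (g' (fpr2 H)))).
- move=> H; have [] := @fprodK _ _ P' Q' (f (fpr1 H)) (g (fpr2 H)).
    by rewrite fne gne; exact: fpr_nonempty.
  by move=> -> ->; rewrite fK gK fprK.
- move=> H; have [] := @fprodK _ _ P Q (f' (fpr1 H)) (g' (fpr2 H)).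
    by rewrite f'ne g'ne; exact: fpr_nonempty.
  by move=> -> ->; rewrite f'K g'K fprK.
- by move=> H K /fpr_le[/fm ? /gm ?]; exact: fprod_le.
- by move=> H K /fpr_le[/f'm ? /g'm ?]; exact: fprod_le.
Qed.

Lemma cprod_class (P Q : polytope) :
  cprod (comb_class P) (comb_class Q) = comb_class (pprod P Q).
Proof.
by apply/comb_classP/pprod_iso; apply/comb_classP; rewrite /comb_class reprK.
Qed.

(* Mutually inverse maps between polytopes that pull linear functionals back
   to linear functionals identify the face lattices. *)
Lemma linear_comb_class (P Q : polytope)
    (phi : 'rV[R]_(ambient_dim P) -> 'rV[R]_(ambient_dim Q))
    (psi : 'rV[R]_(ambient_dim Q) -> 'rV[R]_(ambient_dim P)) :
  (forall x, body P x -> body Q (phi x) /\ psi (phi x) = x) ->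
  (forall y, body Q y -> body P (psi y) /\ phi (psi y) = y) ->
  (forall c : 'cV_(ambient_dim Q), exists c', forall x, phi x *m c = x *m c') ->
  (forall c : 'cV_(ambient_dim P), exists c', forall y, psi y *m c = y *m c') ->
  comb_class P = comb_class Q.
Proof.
move=> PQ QP phic psic; apply/comb_classP.
have pull (A B : polytope)
    (h : 'rV[R]_(ambient_dim B) -> 'rV[R]_(ambient_dim A)) :
    (forall y, body B y -> body A (h y)) ->
    (forall c : 'cV_(ambient_dim A), exists c', forall y, h y *m c = y *m c') ->
    forall F : face A, is_face B [set y | body B y /\ face_set F (h y)].
  move=> BA hc F; have [c [b [cb ->]]] := faceP F.
  have [c' c'E] := hc c; exists c', b; split=> [y /BA/cb|]; rewrite -?c'E //.
  apply/seteqP; split=> y /=; first by case=> By [Ahy]; rewrite c'E.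
  by case=> By; rewrite -c'E => E; split=> //; split=> //; exact: BA.
pose f (F : face P) : face Q :=
  Face (pull P Q psi (fun y h => (QP y h).1) psic F).
pose g (G : face Q) : face P :=
  Face (pull Q P phi (fun x h => (PQ x h).1) phic G).
apply: (@poset_isoI _ _ _ _ f g).
- move=> F; apply: face_eq; apply/seteqP; split=> x /=.
    by case=> /PQ[_ E] [_]; rewrite E.
  by move=> Fx; have /PQ[Qx E] := face_sub Fx; rewrite E;
     split; [exact: face_sub Fx|].
- move=> G; apply: face_eq; apply/seteqP; split=> x /=.
    by case=> /QP[_ E] [_]; rewrite E.
  by move=> Gx; have /QP[Qx E] := face_sub Gx; rewrite E;
     split; [exact: face_sub Gx|].
- by move=> F G s y [Qy /s]; split.
- by move=> F G s y [Qy /s]; split.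
Qed.

Definition cpoint : cpolytope := comb_class point.

Lemma cpolytopeP (p : cpolytope) : exists P : polytope, p = comb_class P.
Proof. by exists (repr p); rewrite /comb_class reprK. Qed.

Fact cprodC : commutative cprod.
Proof.
move=> p q; have [P ->] := cpolytopeP p; have [Q ->] := cpolytopeP q.
rewrite !cprod_class; apply: (linear_comb_class
  (P := pprod P Q) (Q := pprod Q P)
  (phi := fun x => row_mx (rsubmx x) (lsubmx x))
  (psi := fun x => row_mx (rsubmx x) (lsubmx x))).
- move=> x [Px Qx]; split; first by apply/pprod_setE.
  by rewrite row_mxKl row_mxKr hsubmxK.
- move=> x [Px Qx]; split; first by apply/pprod_setE.
  by rewrite row_mxKl row_mxKr hsubmxK.
- move=> c; exists (col_mx (dsubmx c) (usubmx c)) => x.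
  by rewrite -[in LHS](vsubmxK c) -[in RHS](hsubmxK x) !mul_row_col addrC.
- move=> c; exists (col_mx (dsubmx c) (usubmx c)) => x.
  by rewrite -[in LHS](vsubmxK c) -[in RHS](hsubmxK x) !mul_row_col addrC.
Qed.

Fact cprodA : associative cprod.
Proof.
move=> p q r; have [P ->] := cpolytopeP p; have [Q ->] := cpolytopeP q.
have [S ->] := cpolytopeP r; rewrite !cprod_class.
apply: (linear_comb_class
  (P := pprod P (pprod Q S)) (Q := pprod (pprod P Q) S)
  (phi := fun x => row_mx (row_mx (lsubmx x) (lsubmx (rsubmx x)))
                          (rsubmx (rsubmx x)))
  (psi := fun x => row_mx (lsubmx (lsubmx x))
                          (row_mx (rsubmx (lsubmx x)) (rsubmx x)))).
- move=> x [Px [Qx Sx]]; split; last by rewrite !(row_mxKl, row_mxKr, hsubmxK).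
  by apply/pprod_setE; split=> //; apply/pprod_setE.
- move=> x [[Px Qx] Sx]; split; last by rewrite !(row_mxKl, row_mxKr, hsubmxK).
  by apply/pprod_setE; split=> //; apply/pprod_setE.
- move=> c; exists (col_mx (usubmx (usubmx c))
                           (col_mx (dsubmx (usubmx c)) (dsubmx c))) => x.
  rewrite -[in LHS](vsubmxK c) -[in LHS](vsubmxK (usubmx c)).
  rewrite -[in RHS](hsubmxK x) -[in RHS](hsubmxK (rsubmx x)).
  by rewrite !mul_row_col addrA.
- move=> c; exists (col_mx (col_mx (usubmx c) (usubmx (dsubmx c)))
                           (dsubmx (dsubmx c))) => x.
  rewrite -[in LHS](vsubmxK c) -[in LHS](vsubmxK (dsubmx c)).
  rewrite -[in RHS](hsubmxK x) -[in RHS](hsubmxK (lsubmx x)).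
  by rewrite !mul_row_col addrA.
Qed.

Fact cprod1 : left_id cpoint cprod.
Proof.
move=> p; have [P ->] := cpolytopeP p; rewrite cprod_class.
apply: (linear_comb_class (P := pprod point P) (Q := P)
  (phi := fun x => rsubmx x) (psi := fun x => row_mx 0 x)).
- by move=> x [_ Px]; split=> //; rewrite -[RHS]hsubmxK [lsubmx x]thinmx0.
- by move=> x Px; rewrite row_mxKr; split=> //; split; rewrite ?row_mxKr.
- move=> c; exists (col_mx 0 c) => x.
  by rewrite -[in RHS](hsubmxK x) mul_row_col mulmx0 add0r.
- move=> c; exists (dsubmx c) => x.
  by rewrite -[in LHS](vsubmxK c) mul_row_col mul0mx add0r.
Qed.

Fact cprodr1 : right_id cpoint cprod.
Proof. by move=> p; rewrite cprodC cprod1. Qed.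

Fact cprod_unitm (p q : cpolytope) : cprod p q = cpoint ->
  p = cpoint /\ q = cpoint.
Proof.
have H (a b : cpolytope) : cprod a b = cpoint -> a = cpoint.
  have [P ->] := cpolytopeP a; have [Q ->] := cpolytopeP b.
  rewrite cprod_class => /comb_classP/poset_isoE[f [g [fK gK fm gm]]].
  have ne F := @poset_iso_empty _ _ (pprod P Q) point f g F gK fm.
  have full (F : face point) : (F : set _) !=set0 -> F = ffull point.
    move=> [x Fx]; apply: face_eq; apply/seteqP; split=> // y _.
    by have -> : y = x by rewrite [y]thinmx0 [x]thinmx0.
  have [y0 Qy0] := body_nonempty Q.
  have uniqF (F : face P) : (F : set _) !=set0 -> F = ffull P.
    move=> [x Fx].
    have E : fprod F (ffull Q) = fprod (ffull P) (ffull Q).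
      apply: (can_inj fK).
      transitivity (ffull point); last symmetry.
        apply: full; apply: (ne _).2.
        by exists (row_mx x y0); apply/pprod_setE.
      apply: full; apply: (ne _).2.
      exists (row_mx x y0); apply/pprod_setE; split=> //.
      exact: face_sub Fx.
    apply: face_eq; apply/seteqP; split=> [|x' Px']; first exact: face_sub.
    have : (fprod F (ffull Q) : set _) (row_mx x' y0).
      by rewrite E; apply/pprod_setE.
    by case/pprod_setE.
  apply/comb_classP.
  have [x0 Px0] := body_nonempty P.
  pose u (F : face P) : face point :=
    if pselect ((F : set _) !=set0) then ffull point else fempty point.
  pose v (F : face point) : face P :=
    if pselect ((F : set _) !=set0) then ffull P else fempty P.
  have emp n (B : set 'rV[R]_n) (F : face B) :
      ~ ((F : set _) !=set0) -> F = fempty B.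
    move=> no; apply: face_eq; apply/seteqP; split=> // x Fx.
    by apply: no; exists x.
  have u1 (F : face P) : (F : set _) !=set0 -> u F = ffull point.
    by rewrite /u; case: pselect.
  have v1 (F : face point) : (F : set _) !=set0 -> v F = ffull P.
    by rewrite /v; case: pselect.
  have u0 : u (fempty P) = fempty point by rewrite /u; case: pselect => // -[].
  have v0 : v (fempty point) = fempty P by rewrite /v; case: pselect => // -[].
  apply: (@poset_isoI _ _ _ _ u v).
  - move=> F; have [Fn|/emp ->] := pselect ((F : set _) !=set0).
      rewrite (u1 _ Fn) v1; last by exists 0.
      by rewrite -(uniqF F Fn).
    by rewrite u0 v0.
  - move=> F; have [Fn|/emp ->] := pselect ((F : set _) !=set0).
      rewrite (v1 _ Fn) u1; last by exists x0.
      by rewrite -(full F Fn).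
    by rewrite v0 u0.
  - move=> F G FG; have [[x Fx]|/emp ->] := pselect ((F : set _) !=set0).
      by rewrite !u1 //; exists x => //; exact: FG.
    by rewrite u0 => ?.
  - move=> F G FG; have [[x Fx]|/emp ->] := pselect ((F : set _) !=set0).
      by rewrite !v1 //; exists x => //; exact: FG.
    by rewrite v0 => ?.
by move=> E; split; [exact: H E|apply: (H q p); rewrite cprodC].
Qed.

HB.instance Definition _ := Choice_isMonomialDef.Build cpolytope
  cprodA cprod1 cprodr1 cprod_unitm.
HB.instance Definition _ := MonomialDef_isConomialDef.Build cpolytope cprodC.

Definition face_class (P : polytope) (F : nface P) : cpolytope :=
  comb_class (face_polytope F).

(* [F, P] is the interval between [F] and [P] in the face lattice of [P]; it
   is finite and graded, of rank [dim P - dim F], and is isomorphic to the face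
   lattice of the face figure [P / F]. *)
Definition face_interval (P : polytope) (F : nface P) : rota :=
  rota_class (sub_le (@face_le _ P) (P := fun G => face_le F G)).

Context (k : comNzRingType).

(* The set of nonempty faces of a polytope is finite, so the sum is not cut off
   by the convention for sums of infinite support; it does not depend on the
   representative of the combinatorial class. *)
Definition coaction :
    {malg k[cpolytope]} -> {malg k[(cpolytope * rota)%type]} :=
  lext (fun p : cpolytope => let P := repr p in
    \sum_(F \in [set: nface P]) << (1 : k) *g face_class F >> ⊗ << face_interval F >>).

Definition eps : {malg k[cpolytope]} -> k :=
  lext (fun p : cpolytope => (p == mone)%:R : k^o).

(* The vertices of [P] are its 0-dimensional faces. For the point this is
   [v, v] = 1. *)
Definition lmap : {malg k[cpolytope]} -> {malg k[rota]} :=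
  lext (fun p : cpolytope => let P := repr p in
    \sum_(v \in [set v : nface P | affine_dim v = 0%N])
      << (1 : k) *g face_interval v >>).

End Polytopes.

Arguments coaction {R} k x.
Arguments eps {R} k x.
Arguments lmap {R} k x.

(* Main.v *)
Require Import Defs.
From HB Require Import structures.
From mathcomp Require Import all_boot all_order all_algebra.
From mathcomp Require Import boolp classical_sets functions cardinality fsbigop.
From mathcomp Require Import reals finmap monalg.

(* Every identity of the comodule structure is a double count of chains of
   faces: the coaction of [P] sums over faces [F], and applying it to [F] or
   the coproduct to [[F, P]] both give the sum over pairs [E <= F] of
   [E ⊗ [E, F] ⊗ [F, P]].  This uses that the faces of [F] are the faces of [P]
   contained in [F], and that intervals of faces are finite and graded by
   dimension, i.e. that a face covered by [G] has dimension [dim G - 1].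
   Dimension is then combinatorial, [dim P] being the rank of [[v, P]] for any
   vertex [v], and multiplicativity holds because nonempty faces of [P * Q] are
   products of faces, with product intervals above them.  The antipode of the
   Rota-Hopf algebra is the convolution inverse of the identity, given by the
   geometric series in the augmentation ideal. *)

Set Implicit Arguments.
Unset Strict Implicit.
Unset Printing Implicit Defensive.

(* [fprod] and [point] also name library constants. *)
Import Defs.
Import Order.TTheory GRing.Theory Num.Theory.
Local Open Scope classical_set_scope.
Local Open Scope ring_scope.

(** * Finite graded posets and their intervals *)

(** [rota_comul], [grank], [coaction] and [cdim] are defined through chosen representatives of
    classes, so each has to be shown computable in whatever presentation is at hand. To this end
    classes of posets are written as intervals [ivl le x y] of one ambient order: a [gposet] from
    bottom to top, or the nonempty faces of one fixed polytope. The nonempty faces have in general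
    no least element and so do not form a graded poset themselves; [igraded] only asks that
    intervals be graded and covers both cases. Faces are exposed by a single functional. That a face
    of a face is again a face, and that a maximal proper face has codimension one, both fail for
    general convex sets; the proofs choose a maximum, a minimum or a sum over the finitely many
    generators of the hull. *)

Lemma sig_eq (T : Type) (P : T -> Prop) (x y : {z | P z}) :
  sval x = sval y -> x = y.
Proof. exact: eq_sig_hprop => z p q; exact: Prop_irrelevance. Qed.

(** The condition under which [rota_class le] is the class of [le] and not the default value
    [rota_one]. *)
Definition fgraded (T : Type) (le : T -> T -> Prop) : Prop :=
  exists p : gposet, poset_iso (@gle p) le.

Definition between (T : Type) (le : T -> T -> Prop) (x y z : T) : Prop :=
  le x z /\ le z y.

Definition ivl (T : Type) (le : T -> T -> Prop) (x y : T) : rota :=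
  rota_class (sub_le le (P := between le x y)).

Lemma rota_class_iso (T U : Type) (leT : T -> T -> Prop) (leU : U -> U ->
  Prop) :
  poset_iso leT leU -> rota_class leT = rota_class leU.
Proof.
move=> TU; rewrite /rota_class.
suff -> : [set p : gposet | poset_iso (@gle p) leT] =
          [set p : gposet | poset_iso (@gle p) leU] by [].
apply/seteqP; split=> p /= h; first exact: poset_iso_trans h TU.
exact: poset_iso_trans h (poset_iso_sym TU).
Qed.

Lemma rota_class_repr (c : rota) : rota_class (@gle (repr c)) = c.
Proof.
apply: rota_eq; apply: rota_classP; exists (repr c); exact: poset_iso_refl.
Qed.

(** Total maps that are inverse to each other only on the subsets suffice, so no map between
    subtypes has to be built by the caller. *)
Lemma sub_le_iso (T U : Type) (leT : T -> T -> Prop) (leU : U -> U -> Prop)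
    (A : T -> Prop) (B : U -> Prop) (f : T -> U) (g : U -> T) :
  (forall x, A x -> g (f x) = x) -> (forall y, B y -> f (g y) = y) ->
  (forall x, A x -> B (f x)) -> (forall y, B y -> A (g y)) ->
  (forall x y, A x -> A y -> leT x y -> leU (f x) (f y)) ->
  (forall x y, B x -> B y -> leU x y -> leT (g x) (g y)) ->
  poset_iso (sub_le leT (P := A)) (sub_le leU (P := B)).
Proof.
move=> fK gK AB BA fm gm.
apply: (@poset_isoI _ _ _ _
  (fun x : {z | A z} => exist B (f (sval x)) (AB _ (svalP x)))
  (fun y : {z | B z} => exist A (g (sval y)) (BA _ (svalP y)))).
- by move=> [x Ax]; apply: sig_eq; rewrite /= fK.
- by move=> [y By]; apply: sig_eq; rewrite /= gK.
- by move=> [x Ax] [y Ay]; exact: fm.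
- by move=> [x Bx] [y By]; exact: gm.
Qed.

(** Flattens nested subtypes: an interval of an interval becomes an interval of the ambient
    order. *)
Lemma sub_sub_iso (T : Type) (le : T -> T -> Prop) (A : T -> Prop)
    (B : {z | A z} -> Prop) (C : T -> Prop) :
  (forall z (h : A z), B (exist A z h) <-> C z) -> (forall z, C z -> A z) ->
  poset_iso (sub_le (sub_le le (P := A)) (P := B)) (sub_le le (P := C)).
Proof.
move=> BC CA.
have h1 (x : {t | B t}) : C (sval (sval x)).
  by case: x => -[z h] /= /BC.
have h2 (x : {z | C z}) : B (exist A (sval x) (CA _ (svalP x))).
  by apply/BC; exact: svalP.
apply: (@poset_isoI _ _ _ _ (fun x => exist C _ (h1 x))
  (fun x => exist B _ (h2 x))) => //.
- by move=> x; do 2 apply: sig_eq.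
- by move=> x; apply: sig_eq.
Qed.

Lemma ivl_iso (T U : Type) (leT : T -> T -> Prop) (leU : U -> U -> Prop)
    (f : T -> U) (g : U -> T) (x y : T) :
  cancel f g -> cancel g f -> (forall x y, leU (f x) (f y) <-> leT x y) ->
  ivl leT x y = ivl leU (f x) (f y).
Proof.
move=> fK gK fm; apply: rota_class_iso; apply: (sub_le_iso (f := f) (g := g)).
- by move=> z _; rewrite fK.
- by move=> z _; rewrite gK.
- by move=> z [xz zy]; split; rewrite fm.
- by move=> z [xz zy]; split; rewrite -fm gK.
- by move=> u v _ _ uv; rewrite fm.
- by move=> u v _ _ uv; rewrite -fm !gK.
Qed.

Lemma graded_poset_iso (T U : Type) (leT : T -> T -> Prop)
    (leU : U -> U -> Prop) (f : T -> U) (g : U -> T) b t r :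
  cancel f g -> cancel g f -> (forall x y, leU (f x) (f y) <-> leT x y) ->
  graded_poset leT b t r -> graded_poset leU (f b) (f t) (r \o g).
Proof.
move=> fK gK fm [lexx lea let_ leb lee r0 rS].
have gm x y : leU x y <-> leT (g x) (g y) by rewrite -fm !gK.
split=> /=.
- by move=> x; apply/gm.
- by move=> x y /gm xy /gm yx; rewrite -(gK x) (lea _ _ xy yx) gK.
- by move=> x y z /gm xy /gm yz; apply/gm; exact: let_ xy yz.
- by move=> x; apply/gm; rewrite fK.
- by move=> x; apply/gm; rewrite fK.
- by rewrite fK.
- move=> x y [/gm xy nxy c]; apply: rS; split=> //.
    by move=> /(congr1 f); rewrite !gK.
  move=> z xz zy; have [||<-|<-] := c (f z).
  - by apply/gm; rewrite fK.
  - by apply/gm; rewrite fK.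
  - by left; rewrite fK.
  - by right; rewrite fK.
Qed.

Lemma fgraded_iso (T U : Type) (leT : T -> T -> Prop) (leU : U -> U -> Prop) :
  fgraded leT -> poset_iso leT leU -> fgraded leU.
Proof. by case=> p pT TU; exists p; exact: poset_iso_trans pT TU. Qed.

(** [finite_gposet] wants a [finType], which a subtype cut out by a proposition is not; the order is
    transported to the image of [h] in [I]. *)
Lemma fgraded_inj (T : Type) (le : T -> T -> Prop) b t r (I : finType)
    (h : T -> I) : injective h -> graded_poset le b t r -> fgraded le.
Proof.
move=> hI G.
pose J := {i : I | `[< exists x, h x = i >]}.
pose f (x : T) : J := exist _ (h x) (asboolT (ex_intro _ x erefl)).
have gP (j : J) : {x | h x = val j} by apply: cid; exact: (asboolW (valP j)).
pose g (j : J) : T := sval (gP j).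
have fK : cancel f g by move=> x; apply: hI; exact: (svalP (gP (f x))).
have gK : cancel g f by move=> j; apply: val_inj; exact: (svalP (gP j)).
pose leJ (i j : J) := le (g i) (g j).
have fm x y : leJ (f x) (f y) <-> le x y by rewrite /leJ !fK.
have [p pJ] := finite_gposet (graded_poset_iso fK gK fm G).
exists p; apply: (poset_iso_trans pJ); exists g; first by exists f.
by move=> x y.
Qed.

Section GradedPosetTheory.
Variable p : gposet.
Notation gT := 'I_(gsize p).

Lemma grefl (x : gT) : gle x x. Proof. exact: gp_refl (gposetP p) x. Qed.
Lemma ganti (x y : gT) : gle x y -> gle y x -> x = y.
Proof. exact: gp_anti (gposetP p) x y. Qed.
Lemma gtrans (x y z : gT) : gle x y -> gle y z -> gle x z.
Proof. exact: gp_trans (gposetP p) x y z. Qed.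
Lemma gbotP (x : gT) : gle (gbot p) x. Proof. exact: gp_bot (gposetP p) x. Qed.
Lemma gtopP (x : gT) : gle x (gtop p). Proof. exact: gp_top (gposetP p) x. Qed.

(** Among the elements from [x] up to but excluding [y], take one with the most elements below it;
    anything strictly between it and [y] would have more. *)
Lemma lower_cover (x y : gT) : gle x y -> x <> y ->
  exists2 z, gle x z & covers (@gle p) z y.
Proof.
move=> xy nxy; have Px : gle x x && (gle x y && (x != y)).
  by rewrite grefl xy; exact/eqP.
pose M (z : gT) := #|[set w | gle w z]%SET|.
case: (@arg_maxnP _ x (fun z => gle x z && (gle z y && (z != y))) M Px).
move=> z /and3P[xz zy /eqP nzy] zmax; exists z => //; split=> // w zw wy.
have [->|nwy] := eqVneq w y; [by right|left].
have sub : ([set v | gle v z] \subset [set v | gle v w])%SET.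
  by apply/fintype.subsetP => v; rewrite !inE => /gtrans; apply.
have := zmax w; rewrite (gtrans xz zw) wy nwy => /(_ isT) Mw.
have /setP/(_ w) : [set v | gle v z]%SET = [set v | gle v w]%SET.
  by apply/eqP; rewrite eqEcard sub; exact: Mw.
by rewrite !inE grefl => wz; exact: ganti.
Qed.

(** The axiom [gp_rhoS] only speaks of covers, so one descends from [y] through lower covers above
    [x], by induction on the rank. *)
Lemma grho_lt (x y : gT) : gle x y -> x <> y -> (grho x < grho y)%N.
Proof.
move: {2}(grho y) (erefl (grho y)) => n; elim: n y => [|n IH] y En xy nxy.
  have [z _ /(gp_rhoS (gposetP p))] := lower_cover xy nxy.
  by rewrite En.
have [z xz zy] := lower_cover xy nxy.
have E := gp_rhoS (gposetP p) zy; rewrite E ltnS.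
have [->//|/eqP nxz] := eqVneq x z.
by apply/ltnW/IH => //; move: E; rewrite En => -[].
Qed.

Lemma grho_le (x y : gT) : gle x y -> (grho x <= grho y)%N.
Proof.
move=> xy; have [->//|/eqP nxy] := eqVneq x y.
exact/ltnW/grho_lt.
Qed.

(** Whatever lies between two elements of the interval is again in the interval, so covers in the
    interval are covers in [p]. *)
Lemma interval_graded (x y : gT) (xy : gle x y) :
  graded_poset (sub_le (@gle p) (P := between (@gle p) x y))
    (exist _ x (conj (grefl x) xy)) (exist _ y (conj xy (grefl y)))
    (fun z => grho (proj1_sig z) - grho x)%N.
Proof.
split.
- by move=> [z ?]; exact: grefl.
- by move=> [z ?] [w ?] zw wz; apply: sig_eq; exact: ganti.
- by move=> [z ?] [w ?] [v ?]; exact: gtrans.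
- by move=> [z []].
- by move=> [z []].
- by rewrite /= subnn.
move=> [z [xz zy]] [w [xw wy]] [/= zw nzw c].
rewrite (gp_rhoS (gposetP p) (x := z) (y := w)) ?subSn ?grho_le //.
split=> // [E|v zv vw]; first by apply: nzw; apply: sig_eq.
have h : between (@gle p) x y v.
  by split; [exact: gtrans xz zv|exact: gtrans vw wy].
by case: (c (exist _ v h) zv vw) => /(congr1 sval); [left|right].
Qed.

Lemma interval_fgraded (x y : gT) : gle x y ->
  fgraded (sub_le (@gle p) (P := between (@gle p) x y)).
Proof.
move=> xy; apply: (fgraded_inj (h := sval)) (interval_graded xy).
exact: sig_eq.
Qed.

Lemma ivl_bot_top : ivl (@gle p) (gbot p) (gtop p) = rota_class (@gle p).
Proof.
apply: rota_class_iso; apply: (@poset_isoI _ _ _ _ sval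
  (fun x => exist _ x (conj (gbotP x) (gtopP x)))) => //.
by move=> x; apply: sig_eq.
Qed.

End GradedPosetTheory.

(** A rank function is forced by the order, by induction along covers from the bottom; hence [r]
    agrees with the rank function of the representative that defines [grank]. *)
Lemma grank_class (T : Type) (le : T -> T -> Prop) b t r :
  fgraded le -> graded_poset le b t r -> grank (rota_class le) = r t.
Proof.
move=> /rota_classP[f [g fK gK] fm] [lexx lea let_ leb lee r0 rS].
set q := repr _ in f g fK gK fm.
have E x : grho x = r (f x).
  move: {2}(grho x) (erefl (grho x)) => n; elim: n x => [|n IH] x En.
    suff -> : x = gbot q.
      suff -> : f (gbot q) = b by rewrite r0 (gp_rho0 (gposetP q)).
      by apply: lea => //; rewrite -(gK b) fm; exact: gbotP.
    have [//|/eqP nx] := eqVneq x (gbot q).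
    have := grho_lt (gbotP x) (nesym nx).
    by rewrite En.
  have [E|/eqP nx] := eqVneq x (gbot q).
    by rewrite E (gp_rho0 (gposetP q)) in En.
  have [z _ zx] := lower_cover (gbotP x) (nesym nx).
  have Ez := gp_rhoS (gposetP q) zx.
  rewrite Ez IH; last by move: Ez; rewrite En => -[].
  symmetry; apply: rS; case: zx => zx nzx c; split.
  - by rewrite fm.
  - by move/(can_inj fK).
  - move=> w zw wx; have [||Ew|Ew] := c (g w); rewrite -?fm ?gK //.
      by left; rewrite -Ew gK.
    by right; rewrite -Ew gK.
rewrite /grank E; congr r; apply: lea => //.
by rewrite -(gK t) fm; exact: gtopP.
Qed.

Lemma grank_interval (p : gposet) (x y : 'I_(gsize p)) : gle x y ->
  grank (ivl (@gle p) x y) = (grho y - grho x)%N.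
Proof.
by move=> xy; rewrite /ivl (grank_class (interval_fgraded xy)
  (interval_graded xy)).
Qed.

(** Connectedness of the Rota-Hopf algebra, on which the termination of the antipode series
    rests. *)
Lemma grank_eq0 (c : rota) : grank c = 0%N -> c = rota_one.
Proof.
move=> c0; apply: rota_eq; apply: (poset_iso_trans _ (poset_iso_sym (rota_repr
  _))).
have pt (x : 'I_(gsize (repr c))) : x = gbot (repr c).
  have [//|/eqP nx] := eqVneq x (gbot (repr c)).
  have := leq_trans (grho_lt (gbotP x) (nesym nx)) (grho_le (gtopP x)).
  by rewrite -[X in (_ <= X)%N]/(grank c) c0.
apply: (@poset_isoI _ _ _ _ (fun=> ord0) (fun=> gbot (repr c))) => //.
- by move=> x; rewrite (ord1 x).
- by move=> *; exact: grefl.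
Qed.

Lemma grank1 : grank rota_one = 0%N.
Proof.
have h : fgraded (@gle one_gposet).
  by exists one_gposet; exact: poset_iso_refl.
have <- : rota_class (@gle one_gposet) = rota_one.
  by apply: rota_eq; apply: (poset_iso_trans (rota_classP h));
     exact: poset_iso_sym (rota_repr _).
by rewrite (grank_class h (gposetP one_gposet)).
Qed.

Lemma rota_class_prod (T U : Type) (leT : T -> T -> Prop)
    (leU : U -> U -> Prop) : fgraded leT -> fgraded leU ->
  rota_mul (rota_class leT) (rota_class leU) = rota_class (prod_le leT leU).
Proof.
by move=> hT hU; apply: rota_class_iso; apply: prod_le_iso; exact: rota_classP.
Qed.

Lemma prod_fgraded (T U : Type) (leT : T -> T -> Prop)
    (leU : U -> U -> Prop) : fgraded leT -> fgraded leU ->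
  fgraded (prod_le leT leU).
Proof.
case=> p pT [q qU].
have := finite_gposet (prod_graded (gposetP p) (gposetP q)).
by move/fgraded_iso; apply; exact: prod_le_iso.
Qed.

Lemma sub_prod_iso (T U : Type) (leT : T -> T -> Prop) (leU : U -> U -> Prop)
    (A : T -> Prop) (B : U -> Prop) (C : T * U -> Prop) :
  (forall z, C z <-> A z.1 /\ B z.2) ->
  poset_iso (prod_le (sub_le leT (P := A)) (sub_le leU (P := B)))
            (sub_le (prod_le leT leU) (P := C)).
Proof.
move=> CE.
have h1 (x : {z | A z} * {z | B z}) : C (sval x.1, sval x.2).
  by apply/CE; split; exact: svalP.
have h2 (x : {z | C z}) := (CE (sval x)).1 (svalP x).
apply: (@poset_isoI _ _ _ _ (fun x => exist C _ (h1 x))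
  (fun x => (exist A _ (h2 x).1, exist B _ (h2 x).2))) => //.
- by move=> [x y]; congr pair; apply: sig_eq.
- by move=> [[x y] ?]; apply: sig_eq.
Qed.

Lemma ivl_prod (T U : Type) (leT : T -> T -> Prop) (leU : U -> U ->
  Prop) x y x' y' :
  fgraded (sub_le leT (P := between leT x y)) ->
  fgraded (sub_le leU (P := between leU x' y')) ->
  ivl (prod_le leT leU) (x, x') (y, y') = rota_mul (ivl leT x y)
    (ivl leU x' y').
Proof.
move=> h h'; rewrite /ivl rota_class_prod //; apply/esym/rota_class_iso.
apply: sub_prod_iso => -[z z'].
split; first by move=> [[/= ? ?] [/= ? ?]].
by move=> [[/= ? ?] [/= ? ?]].
Qed.

Lemma ivlxx (T : Type) (le : T -> T -> Prop) x :
  (forall x, le x x) -> (forall x y, le x y -> le y x -> x = y) ->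
  ivl le x x = rota_one.
Proof.
move=> lexx lea; apply: rota_eq; apply: (poset_iso_trans _ (poset_iso_sym
  (rota_repr _))).
have iso : poset_iso (@gle one_gposet) (sub_le le (P := between le x x)).
  apply: (@poset_isoI _ _ _ _ (fun=> exist _ x (conj (lexx x) (lexx x)))
    (fun=> ord0)).
  - by move=> i; rewrite (ord1 i).
  - by move=> [z [xz zx]]; apply: sig_eq; exact: lea.
  - by move=> *; exact: lexx.
  - by [].
apply: poset_iso_trans (rota_classP _) (poset_iso_sym iso).
by exists one_gposet.
Qed.

(** * The Rota-Hopf algebra *)

(** The inner sums are padded with zeros to the common range [C], exchanged, and cut down again. *)
Lemma fsbig_exchange_dep (V : nmodType) (I J : choiceType) (A : set I)
    (B : I -> set J) (C : set J) (D : J -> set I) (F : I -> J -> V) :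
  finite_set A -> finite_set C ->
  (forall i j, A i /\ B i j <-> C j /\ D j i) ->
  \sum_(i \in A) \sum_(j \in B i) F i j = \sum_(j \in C) \sum_(i \in D j) F i j.
Proof.
move=> fA fC ABCD.
transitivity (\sum_(i \in A) \sum_(j \in C) patch (fun=> 0) (B i) (F i) j).
  apply: eq_fsbigr => i /set_mem Ai; rewrite -fsbig_mkcondr.
  apply: eq_fsbigl; apply/seteqP; split=> j /= => [Bij|[]//].
  by split=> //; have [] := (ABCD i j).1 (conj Ai Bij).
rewrite exchange_fsbig //; apply: eq_fsbigr => j /set_mem Cj.
transitivity (\sum_(i \in A) patch (fun=> 0) (D j) (F^~ j) i).
  apply: eq_fsbigr => i /set_mem Ai; rewrite /patch.
  congr (if _ then _ else _); apply/idP/idP => /set_mem h; apply/mem_set.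
    by have [] := (ABCD i j).1 (conj Ai h).
  by have [] := (ABCD i j).2 (conj Cj h).
rewrite -fsbig_mkcondr; apply: eq_fsbigl; apply/seteqP.
split=> i /= => [[]//|Dji].
by split=> //; have [] := (ABCD i j).2 (conj Cj Dji).
Qed.

Lemma fsbig_fintype (V : nmodType) (I : finType) (F : I -> V) :
  \sum_(i \in [set: I]) F i = \sum_i F i.
Proof.
rewrite (fsbigE (index_enum I)) ?index_enum_uniq //; last first.
  by move=> i _; rewrite mem_index_enum.
by apply: eq_bigl => i; rewrite in_setT.
Qed.

Lemma fsbig_mul (V : pzSemiRingType) (I J : choiceType) (A : set I)
    (B : set J) (f : I -> V) (g : J -> V) : finite_set A -> finite_set B ->
  (\sum_(i \in A) f i) * (\sum_(j \in B) g j) =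
  \sum_(x \in A `*` B) f x.1 * g x.2.
Proof.
move=> fA fB; rewrite -(pair_fsbig _ (fun i j => f i * g j) fA fB).
rewrite !(fsbig_finite _ _ fA) big_distrl; apply: eq_bigr => i _ /=.
by rewrite !(fsbig_finite _ _ fB) big_distrr.
Qed.

(** * Linear maps on free modules *)

Section LinearMaps.
Variable k : comNzRingType.

Lemma linear_fsum (V W : lmodType k) (g : V -> W) (I : choiceType) (S : set I)
    (F : I -> V) : linear g -> finite_set S ->
  g (\sum_(i \in S) F i) = \sum_(i \in S) g (F i).
Proof.
move=> gl fS; rewrite !fsbig_finite //=.
have gD u v : g (u + v) = g u + g v by have := gl 1 u v; rewrite !scale1r.
by apply: (big_morph g gD); apply: (addIr (g 0)); rewrite -gD !add0r.
Qed.

Lemma contract_l_linear (A B : choiceType) (f : {malg k[A]} -> k) :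
  linear (@contract_l k A B f).
Proof. exact: lext_is_linear. Qed.

Lemma contract_r_linear (A B : choiceType) (f : {malg k[B]} -> k) :
  linear (@contract_r k A B f).
Proof. exact: lext_is_linear. Qed.

Lemma tmap_linear (A B A' B' : choiceType) (f : {malg k[A]} -> {malg k[A']})
    (g : {malg k[B]} -> {malg k[B']}) : linear (tmap f g).
Proof. exact: lext_is_linear. Qed.

Lemma tassoc_linear (A B C : choiceType) : linear (@tassoc k A B C).
Proof. exact: lext_is_linear. Qed.

Lemma tmul_linear (B : conomType) : linear (@tmul k B).
Proof. exact: lext_is_linear. Qed.

Lemma malg_linear_eq (A : choiceType) (V : lmodType k)
    (f g : {malg k[A]} -> V) : linear f -> linear g ->
  (forall a, f << a >> = g << a >>) -> f =1 g.
Proof.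
move=> fl gl fg x.
by rewrite (lext_unique fl (fun=> erefl)) (lext_unique gl (fun=> erefl))
           (funext fg).
Qed.

Lemma malg_morphM (A B : conomType) (f : {malg k[A]} -> {malg k[B]}) :
  linear f -> (forall a b, f << mmul a b >> = f << a >> * f << b >>) ->
  {morph f : x y / x * y}.
Proof.
move=> fl fM; apply: (bilin_eq (f := fun x y => f (x * y))
                               (g := fun x y => f x * f y)).
- by move=> y c u v; rewrite mulrDl -scalerAl fl.
- by move=> x c u v; rewrite mulrDr -scalerAr fl.
- by move=> y c u v; rewrite fl mulrDl -scalerAl.
- by move=> x c u v; rewrite fl mulrDr -scalerAr.
- by move=> a b; rewrite malgMUU.
Qed.

Lemma malg1E (A : conomType) : (1 : {malg k[A]}) = << mone >>.
Proof. by []. Qed.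

Lemma tmulE (B : conomType) (x y : {malg k[B]}) : tmul (x ⊗ y) = x * y.
Proof.
move: x y; apply: (bilin_eq (f := fun x y => tmul (x ⊗ y)) (g :=
  fun x y => x * y)).
- by move=> y c u v; rewrite tens_linear_l [LHS]lext_is_linear.
- by move=> y c u v; rewrite tens_linear_r [LHS]lext_is_linear.
- by move=> y c u v; rewrite mulrDl scalerAl.
- by move=> y c u v; rewrite mulrDr scalerAr.
- by move=> a b; rewrite tensUU [LHS]lextU.
Qed.

Lemma id_linear (V : lmodType k) : linear (id : V -> V).
Proof. by []. Qed.

End LinearMaps.

Record igraded (T : choiceType) (le : T -> T -> Prop) : Prop := IGraded {
  ig_refl : forall x, le x x;
  ig_anti : forall x y, le x y -> le y x -> x = y;
  ig_trans : forall x y z, le x y -> le y z -> le x z;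
  ig_finite : finite_set [set: T];
  ig_interval : forall x y, le x y -> fgraded (sub_le le (P :=
    between le x y)) }.

Lemma igraded_gposet (p : gposet) : igraded (@gle p).
Proof.
split.
- exact: grefl.
- exact: ganti.
- by move=> x y z; exact: gtrans.
- exact: finite_finset.
- exact: interval_fgraded.
Qed.

Lemma igraded_prod (T U : choiceType) (leT : T -> T -> Prop)
    (leU : U -> U -> Prop) : igraded leT -> igraded leU ->
  igraded (prod_le leT leU).
Proof.
case=> Tr Ta Tt Tf Ti [Ur Ua Ut Uf Ui]; split.
- by move=> [x y]; split.
- by move=> [x x'] [y y'] [/= ? ?] [/= ? ?]; congr pair; [exact: Ta|exact: Ua].
- move=> x y z [xy xy'] [yz yz']; split; [exact: Tt xy yz|exact: Ut xy' yz'].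
- by rewrite -setXTT; exact: finite_setX.
- move=> [x x'] [y y'] [/= xy xy'].
  apply: fgraded_iso (prod_fgraded (Ti _ _ xy) (Ui _ _ xy')) _.
  apply: sub_prod_iso => -[z z'].
  split; first by move=> [[/= ? ?] [/= ? ?]].
  by move=> [[/= ? ?] [/= ? ?]].
Qed.

Lemma fsbig_single (V : nmodType) (I : choiceType) (A : set I) (F : I -> V) x :
  A x -> (forall z, A z -> z <> x -> F z = 0) -> \sum_(z \in A) F z = F x.
Proof.
move=> Ax F0; rewrite (fsbigE [:: x]) //=.
- by rewrite big_cons big_nil mem_set // addr0.
- by move=> z /=; rewrite inE => /eqP ->.
- by move=> z Az; rewrite inE => /eqP; exact: F0.
Qed.

Section HomogeneousElements.
Variables (k : comNzRingType) (A : choiceType) (deg : A -> nat).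

Definition hom_elt (d : nat) (x : {malg k[A]}) : Prop :=
  forall a, a \in msupp x -> deg a = d.

Lemma hom_elt0 d : hom_elt d 0.
Proof. by move=> a; rewrite msupp0 inE. Qed.

Lemma hom_eltU a : hom_elt (deg a) << a >>.
Proof. by move=> b /(fsubsetP msuppU_le); rewrite inE => /eqP ->. Qed.

Lemma hom_eltD d x y : hom_elt d x -> hom_elt d y -> hom_elt d (x + y).
Proof.
by move=> hx hy a /(fsubsetP (msuppD_le _ _)); rewrite inE => /orP[/hx|/hy].
Qed.

Lemma hom_eltN d x : hom_elt d x -> hom_elt d (- x).
Proof. by move=> hx a; rewrite msuppN => /hx. Qed.

Lemma hom_elt_fsum d (I : choiceType) (S : set I) (F : I -> {malg k[A]}) :
  finite_set S -> (forall i, S i -> hom_elt d (F i)) ->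
  hom_elt d (\sum_(i \in S) F i).
Proof.
move=> fS hF; rewrite fsbig_finite // big_seq.
elim/big_ind: _ => [|x y|i]; [exact: hom_elt0|exact: hom_eltD|].
by rewrite in_fset_set // => /set_mem/hF.
Qed.

End HomogeneousElements.

Lemma hom_eltM (k : comNzRingType) (A : conomType) (deg : A -> nat) d d'
    (x y : {malg k[A]}) : {morph deg : a b / mmul a b >-> (a + b)%N} ->
  hom_elt deg d x -> hom_elt deg d' y -> hom_elt deg (d + d') (x * y).
Proof. by move=> degM hx hy _ /msuppM_le[a [b [/hx <- /hy <- ->]]]. Qed.

(** Both endpoints are sent to the only element of [one_gposet]. In the counit laws this leaves a
    single nonzero term. *)
Lemma ivl_eq1 (T : choiceType) (le : T -> T -> Prop) x y :
  igraded le -> le x y -> ivl le x y = rota_one -> x = y.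
Proof.
move=> ig xy E; have := rota_classP (ig_interval ig xy).
rewrite -/(ivl le x y) E => /poset_iso_sym h.
have [f [g fK _] _] := poset_iso_trans h (rota_repr _).
pose u := exist (between le x y) x (conj (ig_refl ig x) xy).
pose v := exist (between le x y) y (conj xy (ig_refl ig y)).
by have /(congr1 sval) : u = v by rewrite -(fK u) -(fK v) (ord1 (f u))
  (ord1 (f v)).
Qed.

Lemma grank_mul : {morph grank : c d / rota_mul c d >-> (c + d)%N}.
Proof.
have h (c : rota) : fgraded (@gle (repr c)) by exists (repr c);
  exact: poset_iso_refl.
move=> c d; rewrite /rota_mul (grank_class (prod_fgraded (h c) (h d))
  (prod_graded (gposetP _) (gposetP _))) //.
Qed.

Lemma grank_split (p : gposet) (z : 'I_(gsize p)) :
  grank (ivl (@gle p) (gbot p) (gtop p)) =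
  (grank (ivl (@gle p) (gbot p) z) +
   grank (ivl (@gle p) z (gtop p)))%N.
Proof.
rewrite !grank_interval ?gbotP ?gtopP // (gp_rho0 (gposetP p)) !subn0 subnKC //.
exact/grho_le/gtopP.
Qed.

(** * Coproduct, convolution and antipode *)

Section Rota.
Variable k : comNzRingType.
Notation kR := {malg k[rota]}.

(** Frees the coproduct from the representative. The sum runs over the image of [h] because [T],
    typically a subtype, need not carry a choice structure. *)
Lemma comul_class (T : Type) (le : T -> T -> Prop) (I : choiceType)
    (h : T -> I) (phi : I -> {malg k[(rota * rota)%type]}) :
  fgraded le -> injective h ->
  (forall t, phi (h t) = << (rota_class (sub_le le (P := fun x => le x t)),
                             rota_class (sub_le le (P := fun x => le t x))) >>)
                               ->
  rota_comul k << rota_class le >> = \sum_(i \in range h) phi i.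
Proof.
move=> /rota_classP/poset_isoE[f [g [fK gK fm gm]]] hI phiE.
rewrite /rota_comul lextU /=; set p := repr _ in f g fK gK fm gm *.
have -> : range h = [set h (f z) | z in [set: 'I_(gsize p)]].
  apply/seteqP; split=> i /= [t _ <-]; last by exists (f t).
  by exists (g t); rewrite ?gK.
rewrite (fsbig_image _ (h \o f)); last first.
  by move=> x y _ _ /hI/(can_inj fK).
rewrite fsbig_fintype; apply: eq_bigr => z _; rewrite /= phiE.
rewrite tensUU; congr (<< (_, _) >>); apply: rota_class_iso.
  apply: (sub_le_iso (f := f) (g := g)).
  - by move=> x _; rewrite fK.
  - by move=> x _; rewrite gK.
  - by move=> x; rewrite fm.
  - by move=> x; rewrite -gm fK.
  - by move=> x y _ _; rewrite fm.
  - by move=> x y _ _; rewrite gm.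
apply: (sub_le_iso (f := f) (g := g)).
- by move=> x _; rewrite fK.
- by move=> x _; rewrite gK.
- by move=> x; rewrite fm.
- by move=> x; rewrite -gm fK.
- by move=> x y _ _; rewrite fm.
- by move=> x y _ _; rewrite gm.
Qed.

(** The working form of the coproduct: both factors are again intervals of the same ambient order,
    so the formula can be iterated. *)
Lemma comul_interval (T : choiceType) (le : T -> T -> Prop) x y :
  igraded le -> le x y ->
  rota_comul k << ivl le x y >> =
  \sum_(z \in between le x y) << (1 : k) *g (ivl le x z, ivl le z y) >>.
Proof.
move=> [lexx lea let_ fin ig] xy.
rewrite (comul_class (h := sval) (ig _ _ xy) (@sig_eq _ _)
  (phi := fun z => << (1 : k) *g (ivl le x z, ivl le z y) >>)).
  apply: eq_fsbigl; apply/seteqP; split=> [_ [t _ <-]|z h]; first exact: svalP.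
  by exists (exist _ z h).
move=> [t [xt ty]] /=; congr (<< (_, _) >>); apply/esym/rota_class_iso.
  apply: sub_sub_iso => [z [xz zy]|z [xz zt]]; last first.
    by split=> //; exact: let_ zt ty.
  by rewrite /sub_le /between /=; split=> // -[].
apply: sub_sub_iso => [z [xz zy]|z [tz zy]]; last first.
  by split=> //; exact: let_ xt tz.
by rewrite /sub_le /between /=; split=> // -[].
Qed.

(** The convolution product of linear endomorphisms of [kR], each given by its values on the
    basis. *)
Definition conv (F G : rota -> kR) (c : rota) : kR :=
  lext (fun ab : rota * rota => F ab.1 * G ab.2) (rota_comul k << c >>).

Lemma conv_interval (T : choiceType) (le : T -> T -> Prop) x y F G :
  igraded le -> le x y ->
  conv F G (ivl le x y) = \sum_(z \in between le x y) F (ivl le x z)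
    * G (ivl le z y).
Proof.
move=> ig xy; rewrite /conv comul_interval // (linear_fsum _ (lext_is_linear
  _)); last first.
  exact: sub_finite_set (ig_finite ig).
by apply: eq_fsbigr => z _; rewrite lextU.
Qed.

Lemma comul_is_linear : linear (rota_comul k).
Proof. exact: lext_is_linear. Qed.

Lemma rota_counitU c : rota_counit k << c >> = (c == rota_one)%:R.
Proof. by rewrite /rota_counit lextU. Qed.

(** Presents an arbitrary class as an interval, so that [comul_interval] applies to it. *)
Lemma rota_ind (Q : rota -> Prop) :
  (forall (p : gposet), Q (ivl (@gle p) (gbot p) (gtop p))) -> forall c, Q c.
Proof. by move=> h c; rewrite -[c]rota_class_repr -ivl_bot_top. Qed.

Lemma rota_comul_counit_l (x : kR) : contract_l (rota_counit k)
  (rota_comul k x) = x.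
Proof.
move: x; apply: malg_linear_eq (@id_linear _ _) _ => [c x y|].
  by rewrite comul_is_linear contract_l_linear.
apply: rota_ind => p; have ig := igraded_gposet p.
rewrite comul_interval //; last exact: gbotP.
rewrite (linear_fsum _ (contract_l_linear _)); last exact: finite_finset.
rewrite (fsbig_single (x := gbot p)).
- by rewrite [LHS]lextU /= rota_counitU ivlxx ?eqxx ?scale1r //; apply ig.
- by split; [exact: grefl|exact: gbotP].
move=> z [bz zt] nz; rewrite [LHS]lextU /= rota_counitU.
case: eqP => [/(ivl_eq1 ig bz) E|_]; first by case: nz.
by rewrite scale0r.
Qed.

Lemma rota_comul_counit_r (x : kR) : contract_r (rota_counit k)
  (rota_comul k x) = x.
Proof.
move: x; apply: malg_linear_eq (@id_linear _ _) _ => [c x y|].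
  by rewrite comul_is_linear contract_r_linear.
apply: rota_ind => p; have ig := igraded_gposet p.
rewrite comul_interval //; last exact: gbotP.
rewrite (linear_fsum _ (contract_r_linear _)); last exact: finite_finset.
rewrite (fsbig_single (x := gtop p)).
- by rewrite [LHS]lextU /= rota_counitU ivlxx ?eqxx ?scale1r //; apply ig.
- by split; [exact: gbotP|exact: grefl].
move=> z [bz zt] nz; rewrite [LHS]lextU /= rota_counitU.
case: eqP => [/(ivl_eq1 ig zt) E|_]; first by case: nz.
by rewrite scale0r.
Qed.


Lemma comul_coassoc_interval (T : choiceType) (le : T -> T -> Prop) x y :
  igraded le -> le x y ->
  tassoc (tmap (rota_comul k) id (rota_comul k << ivl le x y >>)) =
  tmap id (rota_comul k) (rota_comul k << ivl le x y >>).
Proof.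
move=> ig xy; have fin (A : set T) := sub_finite_set (@subsetT _ A)
  (ig_finite ig).
rewrite !comul_interval // !(linear_fsum _ (tmap_linear _ _)) //.
rewrite (linear_fsum _ (@tassoc_linear _ _ _ _)) //.
pose t (z w : T) : {malg k[(rota * (rota * rota))%type]} :=
  << (ivl le x w, (ivl le w z, ivl le z y)) >>.
transitivity (\sum_(z \in between le x y) \sum_(w \in between le x z) t z w).
  apply: eq_fsbigr => z /set_mem[xz zy]; rewrite [tmap _ _ _]lextU /=
    comul_interval //.
  rewrite (linear_fsum _ (tens_linear_l _))
    // (linear_fsum _ (@tassoc_linear _ _ _ _)) //.
  by apply: eq_fsbigr => w _; rewrite tensUU [LHS]lextU.
rewrite (fsbig_exchange_dep (C := between le x y) (D :=
  fun w => between le w y)) //.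
  apply: eq_fsbigr => z /set_mem[xz zy]; rewrite [tmap _ _ _]lextU /=
    comul_interval //.
  rewrite (linear_fsum _ (tens_linear_r _)) //.
  by apply: eq_fsbigr => w _; rewrite tensUU.
move=> z w; split=> -[[h1 h2] [h3 h4]]; split; split=> //.
- exact: ig_trans ig _ _ _ h4 h2.
- exact: ig_trans ig _ _ _ h1 h3.
Qed.

Lemma rota_coassoc (x : kR) :
  tassoc (tmap (rota_comul k) id (rota_comul k x)) =
  tmap id (rota_comul k) (rota_comul k x).
Proof.
move: x; apply: malg_linear_eq => [c u v|c u v|].
- by rewrite comul_is_linear tmap_linear tassoc_linear.
- by rewrite comul_is_linear tmap_linear.
apply: rota_ind => p.
by apply: comul_coassoc_interval; [exact: igraded_gposet|exact: gbotP].
Qed.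

Lemma rota_comul_one : rota_comul k 1 = 1.
Proof.
have E := ivlxx (ord0 : 'I_(gsize one_gposet)) (@grefl _) (@ganti _).
rewrite malg1E -[mone]/rota_one -{1}E comul_interval //;
  last exact: igraded_gposet.
by rewrite (fsbig_single (x := ord0)) ?E // => z _; rewrite (ord1 z).
Qed.

Lemma rota_comul_mul : {morph rota_comul k : x y / x * y}.
Proof.
apply: malg_morphM; first exact: comul_is_linear.
apply: rota_ind => p; apply: rota_ind => q.
have [ip iq] := (igraded_gposet p, igraded_gposet q).
have ipq := igraded_prod ip iq.
rewrite -[mmul _ _]/(rota_mul _ _) -ivl_prod;
  try exact/interval_fgraded/gbotP.
rewrite !comul_interval //; try exact: gbotP; last by split; exact: gbotP.
(* The three intervals are whole posets, so the sums become sums over finite types and [pair_big]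
   matches them. *)
have top (r : gposet) : between (@gle r) (gbot r) (gtop r) = setT.
  by apply/seteqP; split=> // z _; split; [exact: gbotP|exact: gtopP].
have -> : between (prod_le (@gle p) (@gle q)) (gbot p, gbot q) (gtop p, gtop q)
  = setT.
  apply/seteqP; split=> // z _.
  by split; split; (exact: gbotP || exact: gtopP).
rewrite !top !fsbig_fintype big_distrl /=.
under [RHS]eq_bigr do rewrite big_distrr /=.
rewrite pair_big /=; apply: eq_bigr => -[z w] _ /=.
by rewrite malgMUU !ivl_prod //; apply: interval_fgraded;
  (exact: gbotP || exact: gtopP).
Qed.

Lemma rota_counit_linear c (x y : kR) :
  rota_counit k (c *: x + y) = c * rota_counit k x + rota_counit k y.
Proof. exact: (lext_is_linear (fun a : rota => (a == mone)%:R : k^o)). Qed.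

Lemma rota_counit_mul : {morph rota_counit k : x y / x * y}.
Proof.
apply: (bilin_eq (V := k^o) (f := fun x y => rota_counit k (x * y))
                 (g := fun x y => rota_counit k x * rota_counit k y)).
- by move=> y c u v; rewrite mulrDl -scalerAl rota_counit_linear.
- by move=> x c u v; rewrite mulrDr -scalerAr rota_counit_linear.
- by move=> y c u v; rewrite rota_counit_linear mulrDl -mulrA.
- by move=> x c u v; rewrite rota_counit_linear mulrDr mulrCA.
move=> a b; rewrite malgMUU !rota_counitU -natrM mulnb;
  congr (nat_of_bool _)%:R.
(* A product of posets has one element exactly when both factors do. *)
apply/eqP/andP => [/rota_unitm[-> ->]|[/eqP -> /eqP ->]]; first by rewrite eqxx.
exact: rota_mul1.
Qed.

Definition conv_unit (c : rota) : kR := (c == rota_one)%:R.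

(** Ranks add up along the coproduct. Products are compared, not factors: in [geom_sum_stable] the
    left factors are out of reach of the induction precisely where the right one vanishes. *)
Lemma eq_conv (F F' G G' : rota -> kR) c :
  (forall a b, (grank a + grank b = grank c)%N -> F a * G b = F' a * G' b) ->
  conv F G c = conv F' G' c.
Proof.
move: c; apply: rota_ind => p E.
have ig := igraded_gposet p.
rewrite !conv_interval //; try exact: gbotP.
apply: eq_fsbigr => z /set_mem[bz zt]; apply: E.
by rewrite -grank_split.
Qed.


Lemma conv1l F c : conv conv_unit F c = F c.
Proof.
transitivity (lext F (contract_l (rota_counit k) (rota_comul k << c >>))).
  rewrite /conv; move: (rota_comul k _); apply: malg_linear_eq.
  - exact: lext_is_linear.
  - by move=> a u v; rewrite contract_l_linear lext_is_linear.
  move=> [a b]; rewrite [contract_l _ _]lextU /= rota_counitU !lextU /conv_unit.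
  by rewrite /= linearZ /= lextU; case: eqP => _;
    rewrite ?mul1r ?scale1r ?mul0r ?scale0r.
by rewrite rota_comul_counit_l lextU.
Qed.

Lemma conv1r F c : conv F conv_unit c = F c.
Proof.
transitivity (lext F (contract_r (rota_counit k) (rota_comul k << c >>))).
  rewrite /conv; move: (rota_comul k _); apply: malg_linear_eq.
  - exact: lext_is_linear.
  - by move=> a u v; rewrite contract_r_linear lext_is_linear.
  move=> [a b]; rewrite [contract_r _ _]lextU /= rota_counitU !lextU /conv_unit.
  by rewrite /= linearZ /= lextU; case: eqP => _;
    rewrite ?mulr1 ?scale1r ?mulr0 ?scale0r.
by rewrite rota_comul_counit_r lextU.
Qed.

Lemma convA F G H c : conv (conv F G) H c = conv F (conv G H) c.
Proof.
(* The product of [F], [G] and [H] on triple tensors; the two bracketings are its values on the two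
   sides of coassociativity. *)
pose t := lext (fun abc : rota * (rota * rota)
  => F abc.1 * (G abc.2.1 * H abc.2.2)).
transitivity (t (tassoc (tmap (rota_comul k) id (rota_comul k << c >>)))).
  rewrite /conv; move: (rota_comul k << c >>); apply: malg_linear_eq.
  - exact: lext_is_linear.
  - by move=> a u v; rewrite tmap_linear tassoc_linear /t lext_is_linear.
  move=> [a b]; rewrite [tmap _ _ _]lextU lextU /= /conv.
  move: (rota_comul k << a >>); apply: malg_linear_eq.
  - by move=> d u v; rewrite lext_is_linear mulrDl scalerAl.
  - by move=> d u v; rewrite tens_linear_l tassoc_linear /t lext_is_linear.
  by move=> [a1 a2]; rewrite tensUU [tassoc _]lextU /t !lextU /= mulrA.
rewrite rota_coassoc /conv; move: (rota_comul k << c >>); apply: malg_linear_eq.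
- by move=> a u v; rewrite tmap_linear /t lext_is_linear.
- exact: lext_is_linear.
move=> [a b]; rewrite [tmap _ _ _]lextU lextU /= /conv.
move: (rota_comul k << b >>); apply: malg_linear_eq.
- by move=> d u v; rewrite tens_linear_r /t lext_is_linear.
- by move=> d u v; rewrite lext_is_linear mulrDr scalerAr.
by move=> [a1 a2]; rewrite tensUU /t !lextU.
Qed.

Lemma convBl F F' G c :
  conv (fun a => F a - F' a) G c = conv F G c - conv F' G c.
Proof.
rewrite /conv /lext -sumrB; apply: eq_bigr => a _.
by rewrite mulrBl scalerBr.
Qed.

Lemma convBr F G G' c :
  conv F (fun a => G a - G' a) c = conv F G c - conv F G' c.
Proof.
rewrite /conv /lext -sumrB; apply: eq_bigr => a _.
by rewrite mulrBr scalerBr.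
Qed.

Lemma conv0l F c : conv (fun=> 0) F c = 0.
Proof. by rewrite /conv /lext big1 // => a _; rewrite mul0r scaler0. Qed.

Lemma conv0r F c : conv F (fun=> 0) c = 0.
Proof. by rewrite /conv /lext big1 // => a _; rewrite mulr0 scaler0. Qed.

Definition augm (c : rota) : kR := << c >> - conv_unit c.

Lemma augm1 : augm rota_one = 0.
Proof. by rewrite /augm /conv_unit eqxx -malg1E subrr. Qed.

(* The partial sums of the geometric series for the convolution inverse of
   the identity, which is [conv_unit + augm].  As [augm] vanishes in rank 0,
   they are stationary in each rank. *)
Fixpoint geom_sum (n : nat) (c : rota) : kR :=
  if n is n'.+1 then conv_unit c - conv (geom_sum n') augm c else 0.

Lemma geom_sumS n c :
  geom_sum n.+1 c = conv_unit c - conv (geom_sum n) augm c.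
Proof. exact: erefl. Qed.

(** The recursion puts [augm] on the right; the same sums satisfy it with [augm] on the left, which
    makes the inverse two-sided. In the induction step both sides expand to the same alternating
    expression. *)
Lemma geom_sum_r n c :
  geom_sum n.+1 c = conv_unit c - conv augm (geom_sum n) c.
Proof.
elim: n c => [|n IH] c; first by rewrite geom_sumS conv0l conv0r.
have El : geom_sum n.+1 = fun a => conv_unit a - conv augm (geom_sum n) a.
  exact: funext IH.
have Er : geom_sum n.+1 = fun a => conv_unit a - conv (geom_sum n) augm a.
  exact: funext (geom_sumS n).
rewrite geom_sumS {1}El Er.
by rewrite convBl conv1l convA (convBr augm conv_unit) conv1r.
Qed.

Lemma geom_sum_stable n m c : (grank c < n)%N -> (grank c < m)%N ->
  geom_sum n c = geom_sum m c.
Proof.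
elim: n m c => // n IH [//|m] c cn cm; rewrite !geom_sumS.
rewrite (@eq_conv _ (geom_sum m) _ augm) // => a b abc.
have [b0|b0] := posnP (grank b).
  by rewrite (grank_eq0 b0) augm1 !mulr0.
have ac : (grank a < grank c)%N by rewrite -abc -addn1 leq_add2l.
by rewrite (IH m) //; exact: leq_trans ac _.
Qed.

(** By [geom_sum_stable] all partial sums of index greater than [grank c] agree at [c]. *)
Definition antip (c : rota) : kR := geom_sum (grank c).+1 c.

Lemma antip_l c : conv antip (fun a => << a >>) c = conv_unit c.
Proof.
transitivity (conv (geom_sum (grank c).+1) (fun a => << a >>) c).
  apply: eq_conv => a b abc.
  by rewrite (@geom_sum_stable (grank c).+1 (grank a).+1) // ltnS -abc leq_addr.
rewrite -[LHS](subrK (conv (geom_sum (grank c).+1) conv_unit c)) -convBr conv1r.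
(* The identity was split as [augm] plus [conv_unit]. Passing to the next partial sum in the second
   term produces the opposite of the first one. *)
by rewrite [X in _ + X](@geom_sum_stable _ (grank c).+2 c)
  // geom_sumS addrC subrK.
Qed.

Lemma antip_r c : conv (fun a => << a >>) antip c = conv_unit c.
Proof.
transitivity (conv (fun a => << a >>) (geom_sum (grank c).+1) c).
  apply: eq_conv => a b abc.
  by rewrite (@geom_sum_stable (grank c).+1 (grank b).+1) // ltnS -abc leq_addl.
rewrite -[LHS](subrK (conv conv_unit (geom_sum (grank c).+1) c)) -convBl conv1l.
by rewrite [X in _ + X](@geom_sum_stable _ (grank c).+2 c)
  // geom_sum_r addrC subrK.
Qed.

Lemma hom_conv_unit c : hom_elt grank (grank c) (conv_unit c).
Proof.
rewrite /conv_unit; case: eqP => [->|_]; last exact: hom_elt0.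
by rewrite malg1E; exact: hom_eltU.
Qed.

Lemma hom_conv F G c : (forall a, hom_elt grank (grank a) (F a)) ->
  (forall a, hom_elt grank (grank a) (G a)) ->
  hom_elt grank (grank c) (conv F G c).
Proof.
move=> hF hG; move: c; apply: rota_ind => p; have ig := igraded_gposet p.
rewrite conv_interval //; last exact: gbotP.
apply: hom_elt_fsum => [|z [bz zt]]; first exact: finite_finset.
by rewrite (grank_split z); exact: hom_eltM grank_mul (hF _) (hG _).
Qed.

Lemma hom_geom_sum n c : hom_elt grank (grank c) (geom_sum n c).
Proof.
elim: n c => [|n IH] c; first exact: hom_elt0.
apply: hom_eltD; first exact: hom_conv_unit.
apply: hom_eltN; apply: hom_conv => // a.
apply: hom_eltD; first exact: hom_eltU.
exact/hom_eltN/hom_conv_unit.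
Qed.

Lemma conv_unitE x : lext conv_unit x = rota_counit k x *: 1.
Proof.
move: x; apply: malg_linear_eq => [|c u v|a]; first exact: lext_is_linear.
  by rewrite rota_counit_linear scalerDl scalerA.
by rewrite lextU rota_counitU /conv_unit; case: eqP; rewrite ?scale1r ?scale0r.
Qed.

Lemma rota_antipode : antipode grank (rota_comul k) (rota_counit k)
  (lext antip).
Proof.
split.
- exact: lext_is_linear.
- by move=> a b; rewrite lextU => /hom_geom_sum.
- move=> x; rewrite -conv_unitE; move: x; apply: malg_linear_eq.
  + by move=> c u v; rewrite comul_is_linear tmap_linear tmul_linear.
  + exact: lext_is_linear.
  move=> a; rewrite lextU -antip_l /conv; move: (rota_comul k _).
  apply: malg_linear_eq.
  + by move=> c u v; rewrite tmap_linear tmul_linear.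
  + exact: lext_is_linear.
  by move=> [u v]; rewrite [tmap _ _ _]lextU tmulE !lextU.
- move=> x; rewrite -conv_unitE; move: x; apply: malg_linear_eq.
  + by move=> c u v; rewrite comul_is_linear tmap_linear tmul_linear.
  + exact: lext_is_linear.
  move=> a; rewrite lextU -antip_r /conv; move: (rota_comul k _).
  apply: malg_linear_eq.
  + by move=> c u v; rewrite tmap_linear tmul_linear.
  + exact: lext_is_linear.
  by move=> [u v]; rewrite [tmap _ _ _]lextU tmulE !lextU.
Qed.

Lemma rota_comul_homogeneous :
  homogeneous grank (tdeg grank grank) (rota_comul k).
Proof.
apply: rota_ind => p; have ig := igraded_gposet p.
rewrite comul_interval //; last exact: gbotP.
apply: hom_elt_fsum => [|z [bz zt]]; first exact: finite_finset.
rewrite (grank_split z).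
exact: (@hom_eltU k _ (tdeg grank grank) (ivl _ _ z, ivl _ z _)).
Qed.

Lemma rota_hopf : graded_hopf_algebra grank (rota_comul k) (rota_counit k).
Proof.
split.
- by split; [exact: grank1|exact: grank_mul].
- exact: comul_is_linear.
- exact: rota_comul_homogeneous.
- exact: rota_counit_linear.
- move=> b /eqP b0; rewrite rota_counitU; case: eqP => // E.
  by rewrite E grank1 in b0.
- exact: rota_coassoc.
- exact: rota_comul_counit_l.
- exact: rota_comul_counit_r.
- exact: rota_comul_mul.
- exact: rota_comul_one.
- exact: rota_counit_mul.
- by rewrite malg1E rota_counitU eqxx.
- by exists (lext antip); exact: rota_antipode.
Qed.

End Rota.

(** * Faces of convex hulls *)

Section Hulls.
Variable R : realType.

Section OneHull.
Variables (m n : nat) (V : 'M[R]_(m, n)).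
Let P := convex_hull V.

Lemma hull_mulmx (w : 'rV[R]_m) (c : 'cV[R]_n) :
  (w *m V *m c) 0 0 = \sum_i w 0 i * (row i V *m c) 0 0.
Proof.
rewrite -mulmxA mxE; apply: eq_bigr => i _.
by rewrite -row_mul [in RHS]mxE.
Qed.

(** The defect [b - c(x)] of a convex combination is the weighted sum of the nonnegative defects of
    the rows, and vanishes only if every term does. *)
Lemma mem_hull_face (F : set 'rV[R]_n) (w : 'rV[R]_m) :
  is_face P F -> simplex w ->
  (F (w *m V) <-> forall i, w 0 i != 0 -> F (row i V)).
Proof.
case=> c [b [le_b ->]] sw; have [w0 w1] := sw.
have rowP i : P (row i V) by exact: hull_row.
have E : b - (w *m V *m c) 0 0 = \sum_i w 0 i * (b - (row i V *m c) 0 0).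
  under eq_bigr do rewrite mulrBr.
  by rewrite sumrB -mulr_suml w1 mul1r hull_mulmx.
have ge0 i : 0 <= w 0 i * (b - (row i V *m c) 0 0).
  by rewrite mulr_ge0 // subr_ge0 le_b.
split=> [[_ wb] i wi|h].
  split=> //; apply/eqP; move/eqP: E; rewrite wb subrr eq_sym psumr_eq0 //.
  move/allP/(_ i (mem_index_enum _)); rewrite /= mulf_eq0 (negbTE wi) /=.
  by rewrite subr_eq0 eq_sym.
split; first by exists w.
apply/eqP; rewrite eq_sym -subr_eq0 E; apply/eqP/big1 => i _.
have [->|/h[_ ->]] := eqVneq (w 0 i) 0; first by rewrite mul0r.
by rewrite subrr mulr0.
Qed.

Lemma face_subP (F G : set 'rV[R]_n) : is_face P F -> is_face P G ->
  (F `<=` G <-> forall i, F (row i V) -> G (row i V)).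
Proof.
move=> hF hG; split=> [FG i|h x Fx]; first exact: FG.
have [w sw E] : P x by case: hF Fx => c [b [_ ->]] [].
by rewrite -E in Fx *; apply/(mem_hull_face hG sw)
  => i /((mem_hull_face hF sw).1 Fx)/h.
Qed.

(** The source of finiteness: a face is encoded by a subset of the finitely many generators. *)
Lemma face_vertices_inj (F G : face P) :
  [set i | `[< (F : set _) (row i V) >]]%SET =
    [set i | `[< (G : set _) (row i V) >]]%SET ->
  F = G.
Proof.
move=> /setP E; apply: face_eq; apply/seteqP; split.
  apply/(face_subP (faceP F) (faceP G)) => i Fi.
  by have := E i; rewrite !inE (asboolT Fi) => /esym/asboolP.
apply/(face_subP (faceP G) (faceP F)) => i Gi.
by have := E i; rewrite !inE (asboolT Gi) => /asboolP.
Qed.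

(* If [c <= b] cuts out [G] and [d <= e] cuts out [F] in [G], then
   [N c + d <= N b + e] cuts out [F] once [N] is large; one more copy of [c]
   makes sure that equality only holds on [G]. *)
Lemma is_face_trans (G F : set 'rV[R]_n) :
  is_face P G -> is_face G F -> is_face P F.
Proof.
move=> [c [b [cb GE]]] [d [e [de FE]]].
have rowP i : P (row i V) by exact: hull_row.
pose s i := b - (row i V *m c) 0 0.
(* [N] dominates every ratio with [s i] nonzero. Division by zero gives 0, so rows with [s i = 0]
   contribute nothing; they lie in [G], where [de] already bounds [d]. *)
pose N := \sum_i `|(row i V *m d) 0 0 - e| / s i.
have s_ge0 i : 0 <= s i by rewrite subr_ge0 cb.
have t_ge0 i : 0 <= `|(row i V *m d) 0 0 - e| / s i by rewrite divr_ge0.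
have E M x : (x *m (M *: c + d)) 0 0 = M * (x *m c) 0 0 + (x *m d) 0 0.
  by rewrite mulmxDr -scalemxAr !mxE.
have NP x : P x -> (x *m (N *: c + d)) 0 0 <= N * b + e.
  apply: hull_le => i; rewrite E -lerBrDl addrAC -mulrBr -/(s i) -lerBlDr.
  have [si0|si0] := eqVneq (s i) 0.
    rewrite si0 mulr0 subr_le0; apply: de; rewrite GE; split=> //.
    by apply/eqP; rewrite eq_sym -subr_eq0 -/(s i) si0.
  apply: (le_trans (ler_norm _)).
  rewrite -ler_pdivrMr ?lt0r ?si0 ?s_ge0 // /N (bigD1 i) //=.
  by rewrite lerDl sumr_ge0.
exists ((N + 1) *: c + d), ((N + 1) * b + e).
have E1 x : (x *m ((N + 1) *: c + d)) 0 0 =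
  (x *m c) 0 0 + (x *m (N *: c + d)) 0 0.
  by rewrite !E mulrDl mul1r addrAC addrC addrA.
have E2 : (N + 1) * b + e = b + (N * b + e).
  by rewrite mulrDl mul1r addrAC addrC.
split=> [x Px|]; first by rewrite E1 E2 lerD ?cb ?NP.
rewrite FE; apply/seteqP; split=> x /=.
  rewrite GE => -[[Px xb] xe]; split=> //.
  by rewrite E xb xe.
case=> Px; rewrite E1 E2 => xE.
have xb : (x *m c) 0 0 = b.
  apply/eqP; rewrite eq_le cb //= -(lerD2r (N * b + e)) -xE lerD2l.
  exact: NP.
split; first by rewrite GE.
by move: xE; rewrite E xb => /addrI/addrI.
Qed.

(** For [x] in the hull the rows span the direction space of the affine hull, so dimension questions
    become rank computations. *)
Definition dirs (x : 'rV[R]_n) : 'M[R]_(m, n) := \matrix_i (row i V - x).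

Lemma hull_dirs x y : P y -> (y - x <= dirs x)%MS.
Proof.
move=> [w [w0 w1] <-]; suff -> : w *m V - x = w *m dirs x by exact: submxMl.
rewrite [w *m dirs x]mulmx_sum_row; under eq_bigr do rewrite rowK scalerBr.
by rewrite sumrB -scaler_suml w1 scale1r -mulmx_sum_row.
Qed.

Lemma affine_dim_hull x : P x -> affine_dim P = \rank (dirs x).
Proof.
move=> Px; apply/eqP; rewrite eqn_leq; apply/andP; split.
  apply/bigmax_leqP => r /asboolP[y [A [Py PA <-]]].
  apply: mxrankS; apply/row_subP => i.
  (* A row of [A] is the difference of [y + row i A - x] and [y - x], both in the row space of
     [dirs x]. *)
  rewrite -[row i A](addKr (y - x)) addrC -[y - x + row i A]addrAC.
  by rewrite addmx_sub ?hull_dirs // eqmx_opp hull_dirs.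
pose f := maxrankfun (dirs x); set r := \rank (dirs x).
have rn : (r < n.+1)%N by rewrite ltnS rank_leq_col.
apply: (@leq_bigmax_cond _ _ (fun r : 'I_n.+1 => r : nat) (Ordinal rn)).
apply/asboolP.
(* [affine_dim] wants a matrix with [n] rows: the [r] independent rows of [dirs x] are padded with
   zero rows, which are admissible as [x] itself is in the hull. *)
pose A : 'M[R]_n := \matrix_i (if insub (val i) is Some j then row (f j)
  (dirs x) else 0).
have rowA i : row i A = 0 \/ exists j, row i A = row j (dirs x).
  by rewrite rowK; case: insubP => [j _ _|_]; [right; exists (f j)|left].
exists x, A; split=> //.
  move=> i; case: (rowA i) => [->|[j ->]]; first by rewrite addr0.
  by rewrite rowK addrC subrK; exact: hull_row.
apply/eqP; rewrite eqn_leq; apply/andP; split.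
  apply: mxrankS; apply/row_subP => i.
  by case: (rowA i) => [->|[j ->]]; [exact: sub0mx|exact: row_sub].
have : row_free (rowsub f (dirs x)) by exact: maxrowsub_free.
rewrite /row_free => /eqP fr; rewrite -[X in (X <= _)%N]fr.
apply: mxrankS; apply/row_subP => j.
have jn : (j < n)%N by apply: leq_trans (ltn_ord j) _; rewrite -ltnS.
suff -> : row j (rowsub f (dirs x)) = row (Ordinal jn) A by exact: row_sub.
by rewrite rowK /= valK row_rowsub.
Qed.

End OneHull.

(** Some coordinate is not constant on the hull; the face where it is maximal is proper. *)
Lemma exists_proper_face m n (V : 'M[R]_(m, n)) :
  convex_hull V !=set0 -> affine_dim (convex_hull V) != 0%N ->
  exists F : set 'rV[R]_n,
    [/\ is_face (convex_hull V) F, F !=set0 & F <> convex_hull V].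
Proof.
move=> [x Px]; rewrite (affine_dim_hull Px) mxrank_eq0.
move=> /matrix0Pn[i [j]]; rewrite !mxE subr_eq0 => ij.
pose c : 'cV[R]_n := delta_mx j 0.
have cE y : (y *m c) 0 0 = y 0 j by rewrite -colE mxE.
have [i0 _ i0P] := arg_maxP (fun k => V k j) (erefl (xpredT i)).
exists [set y | convex_hull V y /\ (y *m c) 0 0 = V i0 j]; split.
- exists c, (V i0 j); split=> // y; apply: hull_le => k.
  by rewrite cE mxE; exact: i0P.
- by exists (row i0 V); split; [exact: hull_row|rewrite cE mxE].
- move=> /seteqP[_ sub]; have [_] := sub _ Px; have [_] := sub _ (hull_row V i).
  by rewrite !cE mxE => ix xx; rewrite ix xx eqxx in ij.
Qed.

Lemma dirs_face_le m m' n (V : 'M[R]_(m, n)) (V' : 'M[R]_(m', n)) x :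
  is_face (convex_hull V) (convex_hull V') -> (dirs V' x <= dirs V x)%MS.
Proof.
case=> c [b [_ E]]; apply/row_subP => i; rewrite rowK; apply: hull_dirs.
by have := hull_row V' i; rewrite E => -[].
Qed.

(** The functional exposing [F] kills the directions of [F]. Were these all the directions of the
    hull, it would be constant there and [F] would be everything. *)
Lemma face_dim_lt m n (V : 'M[R]_(m, n)) (F : set 'rV[R]_n) :
  is_face (convex_hull V) F -> F !=set0 -> F <> convex_hull V ->
  (affine_dim F < affine_dim (convex_hull V))%N.
Proof.
move=> hF F0 nF; have [m' [V' E]] := face_hull hF F0.
case: F0 => x Fx; have [c [b [cb FE]]] := hF.
have Px : convex_hull V x by rewrite FE in Fx; case: Fx.
rewrite (affine_dim_hull Px) E (@affine_dim_hull _ _ V' x); last by rewrite -E.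
apply: rank_ltmx; rewrite ltmxE dirs_face_le -?E //=; apply/negP => le.
apply: nF; apply/seteqP; split; first by rewrite FE => y [].
apply/(face_subP (full_is_face _) hF) => i _.
have xb : (x *m c) 0 0 = b by rewrite FE in Fx; case: Fx.
have D'c : dirs V' x *m c = 0.
  apply/row_matrixP => j; rewrite row_mul rowK row0 mulmxBl.
  have : F (row j V') by rewrite E; exact: hull_row.
  rewrite FE => -[_ jb]; apply/rowP => l; rewrite !ord1 !mxE.
  by move: jb xb; rewrite !mxE => -> ->; rewrite subrr.
have /submxP[D DE] := le.
have : (row i (dirs V x) *m c) 0 0 = 0 by rewrite -row_mul DE -mulmxA D'c mulmx0
  !mxE.
rewrite rowK mulmxBl FE => h; split; first exact: hull_row.
apply/eqP; rewrite -subr_eq0 -xb; move: h; rewrite !mxE => ->.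
exact: eqxx.
Qed.

(* Otherwise there is a vertex [row j V] outside of [F] and a functional [d]
   that is constant on [F] and [row j V] but not on the hull.  Rotating the
   functional of [F] towards [d] until it touches the hull again exposes a
   face strictly between [F] and the hull, as it misses [row j V]. *)
Lemma facet_dim m n (V : 'M[R]_(m, n)) (F : set 'rV[R]_n) :
  is_face (convex_hull V) F -> F !=set0 -> F <> convex_hull V ->
  (forall H, is_face (convex_hull V) H -> F `<=` H ->
    H = F \/ H = convex_hull V) ->
  affine_dim (convex_hull V) = (affine_dim F).+1.
Proof.
move=> hF F0 nF cov; apply/eqP; rewrite eqn_leq face_dim_lt // andbT.
have [m' [V' E]] := face_hull hF F0.
case: F0 => x Fx; have [c [b [cb FE]]] := hF.
have [Px xb] : convex_hull V x /\ (x *m c) 0 0 = b by rewrite FE in Fx;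
  case: Fx.
rewrite (affine_dim_hull Px) [in X in (_ <= X)%N]E (@affine_dim_hull _ _ V' x);
  last by rewrite -E.
have [j nj] : exists j, ~ F (row j V).
  apply: contrapT => no; apply: nF; apply/seteqP; split;
    first by rewrite FE => y [].
  apply/(face_subP (full_is_face _) hF) => i _.
  by apply: contrapT => ni; apply: no; exists i.
rewrite leqNgt; apply/negP => rk.
(* The rank of [B] is at most one more than that of the directions of [F], hence by [rk] below that
   of the hull: some direction lies outside [B]. *)
pose B := (dirs V' x + row j (dirs V x))%MS.
have rB : (\rank B <= (\rank (dirs V' x)).+1)%N.
  apply: (leq_trans (mxrank_adds_leqif _ _)).
  by rewrite -[X in (_ <= X)%N]addn1 leq_add2l rank_leq_row.
have /row_subPn[i] : ~~ (dirs V x <= B)%MS.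
  by apply/negP => /mxrankS /leq_trans/(_ rB); rewrite leqNgt rk.
rewrite submxE => /matrix0Pn[i1 [l]]; rewrite (ord1 i1) {i1} => il.
(* A column of the cokernel of [B], chosen not to vanish on the [i]-th direction. *)
pose d0 : 'cV[R]_n := cokermx B *m delta_mx l 0.
have B0 p (A : 'M[R]_(p, n)) : (A <= B)%MS -> A *m d0 = 0.
  by rewrite submxE => /eqP AB; rewrite /d0 mulmxA AB mul0mx.
have i0 : (row i (dirs V x) *m d0) 0 0 != 0 by rewrite /d0 mulmxA -colE mxE.
have [d [dB di]] : exists d : 'cV[R]_n,
    (forall p (A : 'M[R]_(p, n)), (A <= B)%MS -> A *m d = 0) /\
    0 < (row i (dirs V x) *m d) 0 0.
  have [i_gt|i_le] := ltP 0 ((row i (dirs V x) *m d0) 0 0); first by exists d0.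
  exists (- d0); split=> [p A /B0 A0|]; first by rewrite mulmxN A0 oppr0.
  by rewrite mulmxN mxE oppr_gt0 lt_neqAle i0.
pose a q := (row q (dirs V x) *m d) 0 0.
pose s q := b - (row q V *m c) 0 0.
have s_ge0 q : 0 <= s q by rewrite subr_ge0; apply: cb; exact: hull_row.
have aj : a j = 0 by rewrite /a dB ?mxE // addsmxSr.
have Fd y : F y -> (y *m d) 0 0 = (x *m d) 0 0.
  move=> Fy; apply/eqP; rewrite -subr_eq0.
  have /dB : (y - x <= B)%MS.
    apply: submx_trans (addsmxSl _ _); apply: hull_dirs.
    by rewrite -E.
  by rewrite mulmxBl => /matrixP/(_ 0 0); rewrite !mxE => ->.
have aE q : (row q V *m d) 0 0 = a q + (x *m d) 0 0.
  by rewrite /a rowK mulmxBl !mxE subrK.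
have Fa q : F (row q V) -> a q = 0.
  by move=> /Fd; rewrite aE => /(canRL (addrK _)); rewrite subrr.
(* Ratio test: [t] is the largest amount of [d] that keeps all rows feasible. Only rows with
   [0 < a q] constrain it, and the sign of [d] was chosen so that [i] is one of them. *)
have [q0 aq0 q0P] := arg_minP (fun q => s q / a q) (di : (fun q => 0 < a q) i).
pose t := s q0 / a q0.
have t_ge0 : 0 <= t by rewrite divr_ge0 // ltW.
have tq0 : t * a q0 = s q0 by rewrite divfK // gt_eqF.
pose c' := c + t *: d; pose b' := b + t * (x *m d) 0 0.
have cE y : (y *m c') 0 0 = (y *m c) 0 0 + t * (y *m d) 0 0.
  by rewrite mulmxDr -scalemxAr !mxE.
have cqE q : b' - (row q V *m c') 0 0 = s q - t * a q.
  rewrite cE aE /b' /s mulrDr [t * a q + _]addrC addrA opprD.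
  by rewrite addrA opprD addrACA [X in _ + X - _]subrr addr0.
pose H := [set y | convex_hull V y /\ (y *m c') 0 0 = b'].
have [||HF|HP] := cov H.
- exists c', b'; split=> //; apply: hull_le => q.
  rewrite -subr_ge0 cqE subr_ge0; have [aq|aq] := ltP 0 (a q).
    by rewrite -ler_pdivlMr //; exact: q0P.
  by apply: le_trans (s_ge0 q); rewrite mulr_ge0_le0.
- move=> y Fy; split; first by rewrite FE in Fy; case: Fy.
  by rewrite cE Fd //; congr (_ + _); rewrite FE in Fy; case: Fy.
- have : H (row q0 V).
    split; first exact: hull_row.
    by apply/eqP; rewrite eq_sym -subr_eq0 cqE tq0 subrr.
  by rewrite HF => /Fa aq; rewrite aq ltxx in aq0.
- have : H (row j V) by rewrite HP; exact: hull_row.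
  move=> [_ jb]; apply: nj; rewrite FE; split; first exact: hull_row.
  by apply/eqP; rewrite eq_sym -subr_eq0 -/(s j); have := cqE j;
    rewrite jb subrr aj mulr0 subr0 => <-.
Qed.

End Hulls.

(** * The coaction on polytopes *)

Section PolytopeFaces.
Variable R : realType.
Implicit Types P Q : polytope R.

Lemma is_face_restrict n (P G F : set 'rV[R]_n) :
  is_face P F -> F `<=` G -> G `<=` P -> is_face G F.
Proof.
move=> [c [b [cb E]]] FG GP; exists c, b; split=> [x /GP/cb//|].
apply/seteqP; split=> [x Fx|x [Gx xb]]; last by rewrite E; split=> //;
  exact: GP.
by split; [exact: FG|rewrite E in Fx; case: Fx].
Qed.

Lemma polytope_face_trans P (G F : set 'rV[R]_(ambient_dim P)) :
  is_face P G -> is_face G F -> is_face P F.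
Proof. by have [m [V ->]] := body_hull P; exact: is_face_trans. Qed.

Definition nle n (P : set 'rV[R]_n) (F G : nface P) : Prop := face_le F G.

Lemma nface_eq n (P : set 'rV[R]_n) (F G : nface P) : (F : set _) = G -> F = G.
Proof.
case: F G => F hF [G hG] /= /face_eq E; rewrite -{G}E in hG *.
by congr NFace; exact: Prop_irrelevance.
Qed.

Lemma nle_refl n (P : set 'rV[R]_n) (F : nface P) : nle F F.
Proof. by []. Qed.

Lemma nle_anti n (P : set 'rV[R]_n) (F G : nface P) : nle F G -> nle G F ->
  F = G.
Proof. by move=> FG GF; apply: nface_eq; apply/seteqP. Qed.

Lemma nle_trans n (P : set 'rV[R]_n) (F G H : nface P) :
  nle F G -> nle G H -> nle F H.
Proof. by move=> FG GH x /FG/GH. Qed.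

Definition nfull P : nface P :=
  @NFace _ _ P (ffull P) (body_nonempty P).

Lemma nle_full P (F : nface P) : nle F (nfull P).
Proof. exact: face_sub. Qed.

Lemma nface_inj P : exists m (h : nface P -> {set 'I_m}), injective h.
Proof.
have [m [V E]] := body_hull P.
exists m, (fun F => [set i | `[< (F : set _) (row i V) >]]%SET) => F G FG.
move: F G FG; rewrite E => F G FG; apply: nface_eq.
by rewrite (face_vertices_inj FG).
Qed.

Lemma finite_nface P (A : set (nface P)) : finite_set A.
Proof.
have [m [h hI]] := nface_inj P.
apply: (@sub_finite_set _ _ (h @^-1` setT)) => //.
by apply: finite_preimage; [move=> F G _ _; exact: hI|exact: finite_finset].
Qed.

Lemma nle_is_face P (F G : nface P) : nle F G -> is_face G (F : set _).
Proof. by move=> FG; apply: is_face_restrict (faceP F) FG _;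
  exact: face_sub. Qed.

Lemma nle_dim_lt P (F G : nface P) : nle F G -> F <> G ->
  (affine_dim F < affine_dim G)%N.
Proof.
move=> FG nFG; have [m [V E]] := nface_hull G.
have hF := nle_is_face FG; rewrite E in hF *.
apply: face_dim_lt => //; first exact: nface_nonempty.
by rewrite -E => /nface_eq.
Qed.

Lemma nle_dim_le P (F G : nface P) : nle F G ->
  (affine_dim F <= affine_dim G)%N.
Proof.
move=> FG; have [->//|nFG] := pselect (F = G).
exact/ltnW/nle_dim_lt.
Qed.

(** By transitivity of faces, a face of [G] that contains [F] is a face of [P] between them, so
    [facet_dim] applies inside [G]. *)
Lemma covers_dim P (F G : nface P) : covers (@nle _ P) F G ->
  affine_dim G = (affine_dim F).+1.
Proof.
move=> [FG nFG c]; have [m [V E]] := nface_hull G.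
have hF := nle_is_face FG; rewrite E in hF *.
apply: facet_dim => //.
- exact: nface_nonempty.
- by rewrite -E => /nface_eq.
move=> H; rewrite -E => hH FH.
have hPH : is_face P H by apply: polytope_face_trans (faceP G) hH.
have subHG : H `<=` G by case: hH => d [e [_ ->]] x [].
have H0 : (Face hPH : set _) !=set0.
  by have [x Fx] := nface_nonempty F; exists x; exact: FH.
have [||HF|HG] := c (NFace H0).
- exact: FH.
- exact: subHG.
- by left; rewrite -HF.
- by right; rewrite -HG.
Qed.

Lemma interval_nface_graded P (F G : nface P) (FG : nle F G) :
  graded_poset (sub_le (@nle _ P) (P := between (@nle _ P) F G))
    (exist _ F (conj (@nle_refl _ _ F) FG))
      (exist _ G (conj FG (@nle_refl _ _ G)))
    (fun H => affine_dim (proj1_sig H) - affine_dim F)%N.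
Proof.
split.
- by move=> [H ?]; exact: nle_refl.
- by move=> [H ?] [K ?] HK KH; apply: sig_eq; exact: nle_anti.
- by move=> [H ?] [K ?] [L ?]; exact: nle_trans.
- by move=> [H []].
- by move=> [H []].
- by rewrite /= subnn.
move=> [H [FH HG]] [K [FK KG]] [/= HK nHK c].
rewrite (@covers_dim _ H K) ?subSn ?nle_dim_le //.
split=> // [E|L HL LK]; first by apply: nHK; apply: sig_eq.
have h : between (@nle _ P) F G L.
  by split; [exact: nle_trans FH HL|exact: nle_trans LK KG].
by case: (c (exist _ L h) HL LK) => /(congr1 sval); [left|right].
Qed.

Lemma igraded_nface P : igraded (@nle _ P).
Proof.
split.
- exact: nle_refl.
- exact: nle_anti.
- exact: nle_trans.
- exact: finite_nface.
move=> F G FG; have [m [h hI]] := nface_inj P.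
apply: (fgraded_inj (h := h \o sval)) (interval_nface_graded FG).
by move=> x y /hI/sig_eq.
Qed.

Lemma grank_nface P (F G : nface P) : nle F G ->
  grank (ivl (@nle _ P) F G) = (affine_dim G - affine_dim F)%N.
Proof.
move=> FG; have h := ig_interval (igraded_nface P) FG.
by rewrite /ivl (grank_class h (interval_nface_graded FG)).
Qed.

(** A face containing the nonempty [F] is nonempty, so the interval in the full face lattice already
    lies among the nonempty faces. *)
Lemma face_intervalE P (F : nface P) :
  face_interval F = ivl (@nle _ P) F (nfull P).
Proof.
have ne (G : {G : face P | face_le F G}) : (sval G : set _) !=set0.
  by case: G => G FG; have [x Fx] := nface_nonempty F; exists x; exact: FG.
pose f (G : {G : face P | face_le F G}) : {G | between (@nle _ P) F (nfull P)
  G} :=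
  exist _ (NFace (ne G)) (conj (svalP G) (@nle_full _ (NFace (ne G)))).
pose g (G : {G | between (@nle _ P) F (nfull P) G})
  : {G : face P | face_le F G} :=
  exist (fun G : face P => face_le F G) (nface_face (sval G)) (svalP G).1.
apply: rota_class_iso; apply: (@poset_isoI _ _ _ _ f g) => //.
- by move=> G; apply: sig_eq.
- by move=> G; apply: sig_eq; apply: nface_eq.
Qed.

Definition nlift P (F : nface P) (E : nface (face_polytope F)) : nface P :=
  @NFace _ _ P (Face (polytope_face_trans (faceP F) (faceP E)))
    (nface_nonempty E).

Lemma nlift_le P (F : nface P) (E : nface (face_polytope F)) : nle (nlift E) F.
Proof. exact: (@face_sub _ _ _ E). Qed.
Arguments nlift_le {P F} E.

Lemma nlift_surj P (F E : nface P) : nle E F ->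
  exists E' : nface (face_polytope F), nlift E' = E.
Proof.
move=> EF; exists (@NFace _ _ (face_polytope F)
  (@Face _ _ (face_polytope F) _ (nle_is_face EF)) (nface_nonempty E)).
exact: nface_eq.
Qed.

Lemma nlift_inj P (F : nface P) : injective (@nlift P F).
Proof. by move=> E E' /(congr1 (fun F : nface P => (F : set _)))
  /= /nface_eq. Qed.

Lemma nlift_full P (F : nface P) : nlift (nfull (face_polytope F)) = F.
Proof. exact: nface_eq. Qed.

Lemma interval_nlift P (F : nface P) (E E' : nface (face_polytope F)) :
  ivl (@nle _ (face_polytope F)) E E' =
  ivl (@nle _ P) (nlift E) (nlift E').
Proof.
have h (G : {G : nface P | between (@nle _ P) (nlift E) (nlift E') G}) :
    {G' : nface (face_polytope F) | nlift G' = sval G}.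
  apply: cid; apply: nlift_surj; have [_ GE'] := svalP G.
  exact: nle_trans GE' (nlift_le E').
have hb G : between (@nle _ (face_polytope F)) E E' (sval (h G)).
  have [h1 h2] := svalP G; have := svalP (h G); rewrite /between /nle => GE.
  by split; [move: h1|move: h2]; rewrite -{1}GE.
apply: rota_class_iso; apply: (@poset_isoI _ _ _ _
  (fun G : {G | between (@nle _ (face_polytope F)) E E' G} =>
    exist (between (@nle _ P) (nlift E) (nlift E')) (nlift (sval G)) (svalP G))
  (fun G => exist _ (sval (h G)) (hb G))) => //.
- by move=> G; apply: sig_eq; apply: (@nlift_inj P F); exact: (svalP (h _)).
- by move=> G; apply: sig_eq; exact: (svalP (h _)).
- by move=> G G'; rewrite /sub_le /=; case: (h G) (h G')
    => [K /= <-] [K' /= <-].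
Qed.

Lemma polytope_eq n (B : set 'rV[R]_n) h h' ne ne' :
  @Polytope R n B h ne = @Polytope R n B h' ne'.
Proof. by congr Polytope; exact: Prop_irrelevance. Qed.

Lemma face_class_nlift P (F : nface P) (E : nface (face_polytope F)) :
  face_class (nlift E) = face_class E.
Proof. by congr comb_class; exact: polytope_eq. Qed.

Lemma face_class_full P : face_class (nfull P) = comb_class P.
Proof. by congr comb_class; case: P => *; exact: polytope_eq. Qed.

(** The combinatorial type of a face can thus be read off the face lattice of [P], which is why
    isomorphisms of lattices preserve it. *)
Lemma face_polytope_iso P (F : nface P) :
  poset_iso (@face_le _ _ (face_polytope F))
            (sub_le (@face_le _ _ P) (P := fun G => face_le G F)).
Proof.
have h (G : {G : face P | face_le G F}) : is_face F (sval G : set _).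
  by case: G => G GF /=; apply: is_face_restrict (faceP G) GF _;
    exact: face_sub.
apply: (@poset_isoI _ _ _ _
  (fun G : face (face_polytope F) =>
     exist (fun G : face P => face_le G F)
       (Face (polytope_face_trans (faceP F) (faceP G))) (@face_sub _ _ _ G))
  (fun G => @Face _ _ (face_polytope F) _ (h G))) => //.
- by move=> G; apply: face_eq.
- by move=> G; apply: sig_eq; apply: face_eq.
Qed.

(** * Invariance under combinatorial equivalence *)

Section Isomorphism.
Variables (P Q : polytope R) (f : face P -> face Q) (g : face Q -> face P).
Hypotheses (fK : cancel f g) (gK : cancel g f).
Hypothesis fm : forall x y, face_le (f x) (f y) <-> face_le x y.

Let fne (F : nface P) : (f F : set _) !=set0.
Proof. exact/(poset_iso_empty F gK fm)/nface_nonempty. Qed.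

Definition nmap (F : nface P) : nface Q := NFace (fne F).

Lemma nmap_le F G : nle (nmap F) (nmap G) <-> nle F G.
Proof. exact: fm. Qed.

Lemma nmap_face_class F : face_class (nmap F) = face_class F.
Proof.
apply/comb_classP; apply: (poset_iso_trans (face_polytope_iso _)).
apply: (poset_iso_trans _ (poset_iso_sym (face_polytope_iso _))).
apply: (sub_le_iso (f := g) (g := f)).
- by move=> *; exact: gK.
- by move=> *; exact: fK.
- by move=> G; rewrite -fm gK.
- by move=> G; rewrite -fm.
- by move=> G H _ _; rewrite -{1}(gK G) -{1}(gK H) fm.
- by move=> G H _ _; rewrite fm.
Qed.

Lemma nmap_face_interval F : face_interval (nmap F) = face_interval F.
Proof.
apply: rota_class_iso; apply: (sub_le_iso (f := g) (g := f)).
- by move=> *; exact: gK.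
- by move=> *; exact: fK.
- by move=> G; rewrite -fm gK.
- by move=> G; rewrite -fm.
- by move=> G H _ _; rewrite -{1}(gK G) -{1}(gK H) fm.
- by move=> G H _ _; rewrite fm.
Qed.

Lemma nmap_bij : bijective nmap.
Proof.
have gm x y : face_le (g x) (g y) <-> face_le x y by rewrite -fm !gK.
have gne (G : nface Q) : (g G : set _) !=set0.
  exact/(poset_iso_empty G fK gm)/nface_nonempty.
exists (fun G => NFace (gne G)) => F; apply: nface_eq => /=.
  by rewrite fK.
by rewrite gK.
Qed.

End Isomorphism.

(** Descent on the dimension: in positive dimension there is a proper nonempty face, of smaller
    dimension, and its vertices lift. *)
Lemma exists_vertex P : exists v : nface P, affine_dim v = 0%N.
Proof.
have [d] := ubnP (affine_dim P); elim: d P => // d IH P.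
have [P0 _|Pn0] := eqVneq (affine_dim P) 0%N; first by exists (nfull P).
rewrite ltnS => Pd.
have [F [hF F0 nF]] : exists F : set 'rV[R]_(ambient_dim P),
    [/\ is_face P F, F !=set0 & F <> P].
  have [m [V E]] := body_hull P; have Pne := body_nonempty P.
  by rewrite E in Pn0 Pne *; exact: exists_proper_face.
pose F' := @NFace _ _ P (Face hF) F0.
have FP : F' <> nfull P by move=> /(congr1 (fun G : nface P => (G : set _))).
have lt := nle_dim_lt (nle_full (F := F')) FP.
have [v v0] := IH (face_polytope F') (leq_trans lt Pd).
by exists (nlift v).
Qed.

(** An order-theoretic description of vertices, hence one that can be carried across isomorphisms
    and products. *)
Lemma vertexP P (F : nface P) :
  affine_dim F = 0%N <-> forall E, nle E F -> E = F.
Proof.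
split=> [F0 E EF|Fmin].
  have [//|nEF] := pselect (E = F).
  by have := nle_dim_lt EF nEF; rewrite F0.
have [v v0] := exists_vertex (face_polytope F).
by rewrite -(Fmin (nlift v)) //; exact: nlift_le.
Qed.

Lemma grank_vertex P (v : nface P) : affine_dim v = 0%N ->
  grank (face_interval v) = affine_dim P.
Proof.
move=> v0; rewrite face_intervalE grank_nface; last exact: nle_full.
by rewrite v0 subn0.
Qed.

Lemma cdimE P : cdim (comb_class P) = affine_dim P.
Proof.
have : comb_class (repr (comb_class P)) = comb_class P by rewrite /comb_class
  reprK.
rewrite /cdim; move: (repr _) => Q /comb_classP/poset_isoE[f [g [fK gK fm _]]].
have [v v0] := exists_vertex Q; pose v' := nmap gK fm v.
have [h hK h'K] := nmap_bij fK gK fm.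
have v'0 : affine_dim v' = 0%N.
  apply/vertexP => E Ev'; rewrite -(h'K E); congr (nmap gK fm _).
  by move/vertexP: v0; apply; rewrite -(nmap_le gK fm) h'K.
by rewrite -(grank_vertex v0) -(grank_vertex v'0) nmap_face_interval.
Qed.

(** * Faces of a product *)

Section Products.
Variables P Q : polytope R.

Lemma nprod_nonempty (x : nface P * nface Q) :
  (fprod x.1 x.2 : set _) !=set0.
Proof.
have [y y1] := nface_nonempty x.1; have [z z2] := nface_nonempty x.2.
by exists (row_mx y z); apply/pprod_setE.
Qed.

Definition nprod (x : nface P * nface Q) : nface (pprod P Q) :=
  @NFace _ _ (pprod P Q) (fprod x.1 x.2) (nprod_nonempty x).

Lemma nproj1_nonempty (H : nface (pprod P Q)) : (fpr1 H : set _) !=set0.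
Proof.
have [z Hz] := nface_nonempty H; exists (lsubmx z); exists (rsubmx z).
by rewrite hsubmxK.
Qed.

Lemma nproj2_nonempty (H : nface (pprod P Q)) : (fpr2 H : set _) !=set0.
Proof. exact/fpr_nonempty/nproj1_nonempty. Qed.

Definition nproj (H : nface (pprod P Q)) : nface P * nface Q :=
  (NFace (nproj1_nonempty H), NFace (nproj2_nonempty H)).

(** Nonemptiness is essential: a product with an empty factor is empty and forgets the other
    factor. *)
Lemma nprodK : cancel nprod nproj.
Proof.
move=> [F G]; have [|E1 E2] := @fprodK _ _ _ P Q F G.
  by split=> _; exact: nface_nonempty.
congr pair; apply: nface_eq.
  exact: (congr1 (fun H : face P => (H : set _)) E1).
exact: (congr1 (fun H : face Q => (H : set _)) E2).
Qed.

Lemma nprojK : cancel nproj nprod.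
Proof.
move=> H; apply: nface_eq.
exact: (congr1 (fun H : face (pprod P Q) => (H : set _)) (fprK H)).
Qed.

Lemma nprod_le x y : nle (nprod x) (nprod y) <-> prod_le (@nle _ P) (@nle _ Q)
  x y.
Proof.
split=> [/fpr_le[h1 h2]|[h1 h2]]; last exact: fprod_le.
by rewrite -(nprodK x) -(nprodK y); exact: conj h1 h2.
Qed.

Lemma nprod_full : nprod (nfull P, nfull Q) = nfull (pprod P Q).
Proof. exact: nface_eq. Qed.

Lemma interval_nprod F F' G G' : nle F F' -> nle G G' ->
  ivl (@nle _ (pprod P Q)) (nprod (F, G)) (nprod (F', G')) =
  rota_mul (ivl (@nle _ P) F F') (ivl (@nle _ Q) G G').
Proof.
move=> FF' GG'; rewrite -ivl_prod.
- symmetry; exact: ivl_iso nprodK nprojK nprod_le.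
- exact: (ig_interval (igraded_nface P) FF').
- exact: (ig_interval (igraded_nface Q) GG').
Qed.

Lemma face_class_nprod F G :
  face_class (nprod (F, G)) = cprod (face_class F) (face_class G).
Proof. by rewrite /face_class cprod_class; congr comb_class;
  exact: polytope_eq. Qed.

(** No matrix ranks are computed: a product of vertices is minimal, hence a vertex, and the rank of
    the interval above it is additive. *)
Lemma affine_dim_pprod :
  affine_dim (pprod P Q) = (affine_dim P + affine_dim Q)%N.
Proof.
have [[v v0] [w w0]] := (exists_vertex P, exists_vertex Q).
have vw0 : affine_dim (nprod (v, w)) = 0%N.
  apply/vertexP => H; rewrite -(nprojK H) => /nprod_le[/= h1 h2].
  congr nprod; congr pair; first by move/vertexP: v0; apply.
  by move/vertexP: w0; apply.
have := grank_nface (nle_full (F := nprod (v, w))).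
rewrite -nprod_full interval_nprod; try exact: nle_full.
rewrite grank_mul !grank_nface; try exact: nle_full.
by rewrite v0 w0 vw0 !subn0 nprod_full => <-.
Qed.

End Products.

Lemma cdim_mul : {morph @cdim R : p q / cprod p q >-> (p + q)%N}.
Proof.
move=> p q; have [P ->] := cpolytopeP p; have [Q ->] := cpolytopeP q.
by rewrite cprod_class !cdimE affine_dim_pprod.
Qed.

Lemma cdim1 : cdim (cpoint R) = 0%N.
Proof. by rewrite /cpoint cdimE /affine_dim big_ord1_cond; case: ifP. Qed.

(** In dimension 0 the only faces are the empty and the full one, whatever the ambient space. This
    lets [eps] detect vertices. *)
Lemma cdim_eq0 (p : cpolytope R) : cdim p = 0%N -> p = cpoint R.
Proof.
have [P ->] := cpolytopeP p; rewrite cdimE => P0; apply/comb_classP.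
have full (Q : polytope R) (F : face Q) : affine_dim Q = 0%N ->
    (F : set _) !=set0 -> F = ffull Q.
  move=> /(vertexP (nfull Q)) Qmin F0.
  have := Qmin (@NFace _ _ Q F F0) (face_sub (F := F)).
  by move=> /(congr1 (fun G : nface Q => nface_face G)).
have pt0 : affine_dim (point R) = 0%N by rewrite -cdimE cdim1.
have emp (Q : polytope R) (F : face Q) : ~ ((F : set _) !=set0) -> F = fempty Q.
  by move=> no; apply: face_eq; apply/seteqP; split=> // x Fx; case: no;
    exists x.
pose u (Q Q' : polytope R) (F : face Q) : face Q' :=
  if pselect ((F : set _) !=set0) then ffull Q' else fempty Q'.
have u1 (Q Q' : polytope R) (F : face Q) : (F : set _) !=set0 ->
  u Q Q' F = ffull Q'.
  by rewrite /u; case: pselect.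
have u0 (Q Q' : polytope R) : u Q Q' (fempty Q) = fempty Q'.
  by rewrite /u; case: pselect => // -[].
have uK (Q Q' : polytope R) : affine_dim Q = 0%N -> cancel (u Q Q') (u Q' Q).
  move=> Q0 F; have [F0|/emp ->] := pselect ((F : set _) !=set0).
    rewrite (u1 Q Q' F F0) (u1 Q' Q (ffull Q') (body_nonempty Q')).
    exact: esym (full Q F Q0 F0).
  by rewrite !u0.
have um (Q Q' : polytope R) (F G : face Q) : face_le F G ->
  face_le (u Q Q' F) (u Q Q' G).
  move=> FG; have [[x Fx]|/emp ->] := pselect ((F : set _) !=set0).
    by rewrite !u1 //; exists x => //; exact: FG.
  by rewrite u0.
exact: (@poset_isoI _ _ _ _ (u P (point R)) (u (point R) P)) (uK _ _ P0)
  (uK _ _ pt0) (um _ _) (um _ _).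
Qed.

(** * The comodule axioms *)

Section Coaction.
Variable k : comNzRingType.
Notation kP := {malg k[cpolytope R]}.

(** Independence of the representative: the sum is reindexed along the isomorphism of face
    lattices. *)
Lemma coaction_class P :
  coaction k << comb_class P >> =
  \sum_(F \in [set: nface P])
     << (1 : k) *g face_class F >> ⊗ << face_interval F >>.
Proof.
rewrite /coaction lextU /=.
have : comb_class (repr (comb_class P)) = comb_class P by rewrite /comb_class
  reprK.
move: (repr _) => Q /comb_classP/poset_isoE[f [g [fK gK fm _]]].
rewrite (reindex_fsbigT _ _ (nmap_bij fK gK fm)); apply: eq_fsbigr => F _.
by rewrite (nmap_face_class fK) (nmap_face_interval fK).
Qed.

Lemma coactionU P :
  coaction k << comb_class P >> =
  \sum_(F \in [set: nface P])
     << (1 : k) *g (face_class F, ivl (@nle _ P) F (nfull P)) >>.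
Proof.
rewrite coaction_class; apply: eq_fsbigr => F _.
by rewrite tensUU face_intervalE.
Qed.

(** Expressed inside the single ambient polytope [P], so that iterating the coaction sums over
    chains of faces of [P]. *)
Lemma coaction_face_class P (F : nface P) :
  coaction k << face_class F >> =
  \sum_(E \in [set E | nle E F])
     << (1 : k) *g (face_class E, ivl (@nle _ P) E F) >>.
Proof.
rewrite coactionU (reindex_fsbig (@nlift P F) [set: nface (face_polytope F)]).
  apply: eq_fsbigr => E _.
  by rewrite face_class_nlift interval_nlift nlift_full.
split=> [E _|E E' _ _|E /= /nlift_surj[E' <-]]; last by exists E'.
- exact: nlift_le.
- exact: nlift_inj.
Qed.

Lemma coaction_linear : linear (@coaction R k).
Proof. exact: lext_is_linear. Qed.

Lemma coaction_coassoc (x : kP) :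
  tassoc (tmap (coaction k) id (coaction k x)) =
  tmap id (rota_comul k) (coaction k x).
Proof.
move: x; apply: malg_linear_eq => [c u v|c u v|p].
- by rewrite coaction_linear tmap_linear tassoc_linear.
- by rewrite coaction_linear tmap_linear.
have [P ->] := cpolytopeP p; have fin := @finite_nface P.
rewrite coactionU !(linear_fsum _ (tmap_linear _ _)) //.
rewrite (linear_fsum _ (@tassoc_linear _ _ _ _)) //.
pose t (E F : nface P) : {malg k[(cpolytope R * (rota * rota))%type]} :=
  << (face_class E, (ivl (@nle _ P) E F,
                     ivl (@nle _ P) F (nfull P))) >>.
transitivity (\sum_(F \in [set: nface P]) \sum_(E \in [set E | nle E F]) t E F).
  apply: eq_fsbigr => F _; rewrite [tmap _ _ _]lextU /= coaction_face_class.
  rewrite (linear_fsum _ (tens_linear_l _)) //.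
  rewrite (linear_fsum _ (@tassoc_linear _ _ _ _)) //.
  by apply: eq_fsbigr => E _; rewrite tensUU [LHS]lextU.
rewrite (fsbig_exchange_dep (C := setT)
  (D := fun E => between (@nle _ P) E (nfull P))) //; last first.
  by move=> F E; split=> -[_]; [split; split=> //; exact: nle_full|case].
apply: eq_fsbigr => E _; rewrite [tmap _ _ _]lextU /=.
rewrite (comul_interval _ (igraded_nface P)); last exact: nle_full.
rewrite (linear_fsum _ (tens_linear_r _)) //.
by apply: eq_fsbigr => F _; rewrite tensUU.
Qed.

Lemma coaction_counit (x : kP) : contract_r (rota_counit k) (coaction k x) = x.
Proof.
move: x; apply: malg_linear_eq (@id_linear _ _) _ => [c u v|p].
  by rewrite coaction_linear contract_r_linear.
have [P ->] := cpolytopeP p; have fin := @finite_nface P.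
rewrite coactionU (linear_fsum _ (contract_r_linear _)) //.
rewrite (fsbig_single (x := nfull P)) // => [|F _ nF].
  rewrite [LHS]lextU /= rota_counitU ivlxx ?eqxx ?scale1r.
  - by rewrite face_class_full.
  - exact: nle_refl.
  - exact: nle_anti.
rewrite [LHS]lextU /= rota_counitU; case: eqP => [E|_]; last by rewrite scale0r.
by case: nF; exact: ivl_eq1 (igraded_nface P) (@nle_full _ F) E.
Qed.

Lemma coaction_homogeneous :
  homogeneous (@cdim R) (tdeg (@cdim R) grank) (@coaction R k).
Proof.
move=> p; have [P ->] := cpolytopeP p; rewrite coactionU cdimE.
apply: hom_elt_fsum => [|F _]; first exact: finite_nface.
suff <- : tdeg (@cdim R) grank
    (face_class F, ivl (@nle _ P) F (nfull P)) = affine_dim P.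
  exact: hom_eltU.
rewrite /tdeg /= cdimE grank_nface; last exact: nle_full.
by rewrite subnKC //; exact: (nle_dim_le (@nle_full _ F)).
Qed.

Lemma coaction_one : coaction k (1 : kP) = 1.
Proof.
rewrite malg1E -[mone]/(comb_class (point R)) coactionU.
have full (F : nface (point R)) : F = nfull (point R).
  have pt0 : affine_dim (nfull (point R)) = 0%N by rewrite -[RHS]cdim1 -cdimE.
  by move/vertexP: pt0; apply; exact: nle_full.
rewrite (fsbig_single (x := nfull (point R))) //.
rewrite face_class_full ivlxx //; first exact: nle_refl.
exact: nle_anti.
Qed.

Lemma coaction_mul : {morph @coaction R k : x y / x * y}.
Proof.
apply: malg_morphM; first exact: coaction_linear.
move=> p q; have [P ->] := cpolytopeP p; have [Q ->] := cpolytopeP q.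
rewrite -[mmul _ _]/(cprod _ _) cprod_class !coactionU.
rewrite (reindex_fsbigT _ _ (Bijective (@nprodK P Q) (@nprojK P Q))).
rewrite [RHS]fsbig_mul; try exact: finite_nface.
rewrite setXTT; apply: eq_fsbigr => -[F G] _.
by rewrite malgMUU -nprod_full interval_nprod ?face_class_nprod //;
  exact: nle_full.
Qed.

Lemma eps_coaction P :
  contract_l (eps k) (coaction k << comb_class P >>) =
    lmap k << comb_class P >>.
Proof.
rewrite /lmap lextU /=; set Q := repr _.
(* [lmap] sums over the vertices of the representative [Q]; expanding the coaction at [Q] as well
   allows a termwise comparison. *)
have <- : comb_class Q = comb_class P by rewrite /comb_class reprK.
rewrite coactionU (linear_fsum _ (contract_l_linear _));
  last exact: finite_nface.
rewrite [RHS]fsbig_mkcond; apply: eq_fsbigr => F _.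
rewrite [LHS]lextU /= /eps lextU /patch face_intervalE.
(* The unit of the monoid is the class of the point, and the faces in this class are those of
   dimension 0. *)
have -> : (face_class F == mone) = (F \in [set v : nface Q | affine_dim v =
  0%N]).
  apply/eqP/idP => [E|/set_mem F0]; last by apply: cdim_eq0; rewrite cdimE.
  by apply/mem_set; rewrite /= -[RHS](cdim1) -[cpoint R]E cdimE.
by case: (_ \in _); rewrite ?scale1r ?scale0r.
Qed.

Lemma polytope_comodule :
  right_graded_hopf_comodule (@cdim R) grank
    (rota_comul k) (rota_counit k) (@coaction R k).
Proof.
split.
- exact: rota_hopf.
- by split; [exact: cdim1|exact: cdim_mul].
- exact: coaction_linear.
- exact: coaction_homogeneous.
- exact: coaction_coassoc.
- exact: coaction_counit.
- exact: coaction_mul.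
- exact: coaction_one.
Qed.

End Coaction.

End PolytopeFaces.

Theorem proposition37 (R : realType) (k : comNzRingType)
    (hk : k = int \/ k = rat) :
  [/\ (forall P : polytope R,
         coaction k << comb_class P >> =
         \sum_(F \in [set: nface P])
            << (1 : k) *g face_class F >> ⊗ << face_interval F >>),
      right_graded_hopf_comodule (@cdim R) grank
        (rota_comul k) (rota_counit k) (@coaction R k) &
      (forall P : polytope R,
         contract_l (eps k) (coaction k << comb_class P >>) =
         lmap k << comb_class P >>)].
Proof.
split.
- exact: coaction_class.
- exact: polytope_comodule.
- exact: eps_coaction.
Qed.
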